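(* There exist absolute constants $c>0$ and $\delta>0$ such that the following holds. Let $D$ be an integral domain of characteristic zero and let $A$ be a finite subset of $\mathrm{SL}_2(D)$. Let $\langle A\rangle$ be the subgroup of $\mathrm{SL}_2(D)$ generated by $A$. If $\langle A\rangle$ is infinite and not metabelian, then $$|AAA|> c\,|A|^{1+\delta}.$$
   Context: $\mathrm{SL}_2(D)$ is the group of $2\times 2$ matrices with entries in $D$ and determinant $1$. $AAA:=\{a_1a_2a_3: a_i\in A\}$. A group $G$ is metabelian if it has a normal subgroup $N$ such that both $N$ and $G/N$ are abelian. *)

(* Defs.v *)
From HB Require Import structures.
From mathcomp Require Import all_boot all_order all_algebra.
Set Implicit Arguments. Unset Strict Implicit. Unset Printing Implicit Defensive.
Import GRing.Theory.
Local Open Scope ring_scope.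

Definition char_zero (D : idomainType) : Prop := [pchar D] =i pred0.

Definition inSL2 (D : idomainType) (M : 'M[D]_2) : bool := \det M == 1.

Definition AAA (D : idomainType) (A : seq 'M[D]_2) : seq 'M[D]_2 :=
  undup (allpairs (@mulmx D 2 2 2) (allpairs (@mulmx D 2 2 2) A A) A).

Inductive gen (D : idomainType) (A : seq 'M[D]_2) : 'M[D]_2 -> Prop :=
  | gen_base x : x \in A -> gen A x
  | gen_one : gen A 1%:M
  | gen_mul x y : gen A x -> gen A y -> gen A (x *m y)
  | gen_inv x : gen A x -> gen A (invmx x).

Definition infinite_set (D : idomainType) (G : 'M[D]_2 -> Prop) : Prop :=
  ~ exists s : seq 'M[D]_2, forall x, G x -> x \in s.

Definition metabelian (D : idomainType) (G : 'M[D]_2 -> Prop) : Prop :=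
  exists N : 'M[D]_2 -> Prop,
    (forall x, N x -> G x) /\
    N 1%:M /\
    (forall x y, N x -> N y -> N (x *m y)) /\
    (forall x, N x -> N (invmx x)) /\
    (forall g n, G g -> N n -> N (g *m n *m invmx g)) /\
    (forall x y, N x -> N y -> x *m y = y *m x) /\
    (forall g h, G g -> G h -> N (g *m h *m invmx g *m invmx h)).

(* Main.v *)
Require Import Defs.
From HB Require Import structures.
From mathcomp Require Import all_boot all_order all_algebra.
From mathcomp Require Import zify ring lra.
From Stdlib Require Import Classical.
Set Implicit Arguments. Unset Strict Implicit. Unset Printing Implicit Defensive.

(** Let t = |AAA| and a = |A|.  By Ruzsa's triangle inequality every set of
    words of fixed length in A and A^-1 has at most a (t/a)^O(1) elements, so if
    t is smaller than a^(1 + delta) each such set is an approximate group.  A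
    subset X of density (t/a)^-O(1) meets many of its translates z X b^-1 in
    subsets of the same kind of density.  Starting from a conjugacy class, which
    lies in a hyperplane tr = const, intersecting with translates cuts it down
    to linear subspaces of M_2(K) of dimension 3, 2, 1, which is absurd, unless
    the generators fix a line of sl_2(K).  Hence conjugacy classes are sparse, and
    by orbit-stabilizer the centralizer of every non-scalar short word meets
    A^-1 A in a non-scalar element.  The lines of sl_2(K) given by A^-1 A are then
    permuted by the group, and a finite orbit of lines forces the group to fix
    a line (so to be metabelian: the centralizer of the line is abelian and
    the quotient acts on the line by a character) or to be finite.  No
    eigenvalues are needed: K is the fraction field of D. *)

(** * Counting in groups *)

Section Combinatorics.
Local Open Scope nat_scope.

Lemma sum_const_seq (T : Type) (s : seq T) (n : nat) :
  \sum_(x <- s) n = size s * n.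
Proof. by rewrite big_const_seq count_predT iter_addn_0 mulnC. Qed.

Lemma sum_pigeonhole (T : eqType) (s : seq T) (f : T -> nat) (q : nat) :
  0 < q -> q <= \sum_(z <- s) f z -> exists2 z, z \in s & q <= size s * f z.
Proof.
move=> q0 qs; case: (boolP (has (fun z => q <= size s * f z) s)).
  by case/hasP=> z zs qz; exists z.
rewrite -all_predC => /allP H; exfalso.
have {}H z : z \in s -> size s * f z <= q.-1 by move=> /H /=; lia.
have : size s * \sum_(z <- s) f z <= size s * q.-1.
  rewrite big_distrr /= -[X in _ <= X]sum_const_seq.
  by rewrite big_seq [X in _ <= X]big_seq; apply: leq_sum.
case: s qs {H} => [|x s] qs; first by move: qs; rewrite big_nil; lia.
by rewrite leq_pmul2l //; lia.
Qed.

Lemma size_le_fibres (T U : eqType) (f : T -> U) (s : seq T) (k : nat) :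
  (forall y, size [seq x <- s | f x == y] <= k) ->
  size s <= k * size (undup (map f s)).
Proof.
move=> H; set u := undup _.
have -> : size s = \sum_(y <- u) size [seq x <- s | f x == y].
  transitivity (\sum_(x <- s) \sum_(y <- u) (f x == y : nat)).
    rewrite -sum1_size !big_seq; apply: eq_bigr => x xs.
    have fu : f x \in u by rewrite mem_undup map_f.
    rewrite (bigD1_seq (f x)) ?undup_uniq //= eqxx big1 // => y.
    by rewrite eq_sym => /negbTE->.
  rewrite exchange_big /=; apply: eq_bigr => y _.
  by rewrite size_filter -sum1_count [RHS]big_mkcond; apply: eq_bigr => x _; case: eqP.
apply: leq_trans (_ : \sum_(y <- u) k <= _); first exact: leq_sum.
by rewrite sum_const_seq mulnC.
Qed.

Lemma size_le_inj (T U : eqType) (f : T -> U) (s : seq T) (r : seq U) :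
  uniq s -> {in s &, injective f} -> (forall x, x \in s -> f x \in r) ->
  size s <= size r.
Proof.
move=> us inj sr; rewrite -(size_map f); apply: uniq_leq_size.
  by rewrite map_inj_in_uniq.
by move=> _ /mapP[x xs ->]; exact: sr.
Qed.

Variable G : groupType.
Implicit Types (X Y Z W E : seq G) (b x y z : G).
Local Open Scope group_scope.

(** Double counting of the pairs (s, t) in X by the value z = s b t^-1. Each s yields |X| distinct
    values in W, at most |E| of them in E, so some z outside E is attained by at least the average
    number of s. For such s, t = z^-1 s b lies in X. The list E serves to exclude values of z that
    would give no new information. *)
Lemma popular_translate X W E b :
  uniq X -> (size E < size X)%N ->
  (forall s t, s \in X -> t \in X -> s * b * t^-1 \in W) ->
  exists2 z, z \notin E &
    (size X * (size X - size E) <= size W * size [seq s <- X | (z^-1 * s * b)%g \in X])%N.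
Proof.
move=> uX EX XW; pose V := [seq z <- W | z \notin E].
have [z zV Hz] : exists2 z, z \in undup V &
    (size X * (size X - size E) <=
     size (undup V) * size [seq s <- X | (z^-1 * s * b)%g \in X])%N.
  apply: sum_pigeonhole; first by rewrite muln_gt0 subn_gt0 EX andbT; case: (X) EX.
  rewrite [X in (_ <= X)%N](_ : _ =
     \sum_(s <- X) count (fun z => (z^-1 * s * b)%g \in X) (undup V)); last first.
    under eq_bigr => z _ do rewrite size_filter -sum1_count big_mkcond.
    by rewrite exchange_big; apply: eq_bigr => s _; rewrite -sum1_count [RHS]big_mkcond.
  rewrite -sum_const_seq big_seq [X in (_ <= X)%N]big_seq.
  apply: leq_sum => s sX; rewrite -size_filter.
  set T := [seq z <- _ | _].
  have : (size X <= size (E ++ T))%N.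
    apply: (@size_le_inj _ _ (fun t => s * b * t^-1)) => //.
      by move=> t t' _ _ /mulgI /invg_inj.
    move=> t tX; rewrite mem_cat; case: (boolP (_ \in E)) => //= tE.
    rewrite mem_filter mem_undup mem_filter tE XW // invgM invgK invgM !andbT.
    by rewrite -!mulgA mulKg mulVg mulg1.
  by rewrite size_cat; lia.
exists z; first by move: zV; rewrite mem_undup mem_filter => /andP[].
apply: leq_trans Hz _; rewrite leq_mul2r; apply/orP; right.
by apply: leq_trans (size_undup _) _; rewrite size_filter count_size.
Qed.

Definition pset X Y : seq G := undup [seq x * y | x <- X, y <- Y].
Definition iset X : seq G := [seq x^-1 | x <- X].

Lemma mem_pset X Y x y : x \in X -> y \in Y -> x * y \in pset X Y.
Proof. by move=> xX yY; rewrite mem_undup; apply/allpairsP; exists (x, y). Qed.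

Lemma psetP X Y z :
  reflect (exists x y, [/\ x \in X, y \in Y & z = x * y]) (z \in pset X Y).
Proof.
rewrite mem_undup; apply: (iffP allpairsP) => [[[x y] [? ? ->]]|[x [y [? ? ->]]]].
  by exists x, y.
by exists (x, y).
Qed.

Lemma mem_iset X x : (x \in iset X) = (x^-1 \in X).
Proof. by rewrite -{1}[x]invgK mem_map //; exact: invg_inj. Qed.

(** For each d in YZ fix a factorization d = y z. The map (x, d) to (y x, x^-1 z) is injective: the
    product of the two coordinates is d, which determines y and then x. *)
Lemma ruzsa_triangle X Y Z : uniq X ->
  (size X * size (pset Y Z) <= size (pset Y X) * size (pset (iset X) Z))%N.
Proof.
move=> uX.
have dec d : exists y, d \in pset Y Z -> y \in Y /\ y^-1 * d \in Z.
  case: (boolP (d \in _)) => [/psetP[y [z [yY zZ ->]]]|]; last by exists 1.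
  by exists y; rewrite mulKg.
(* [f d] is the first admissible left factor of d. The default 1 is returned only when d has no
   factorization. *)
pose f d := nth 1 [seq y <- Y | y^-1 * d \in Z] 0.
have fP d : d \in pset Y Z -> f d \in Y /\ (f d)^-1 * d \in Z.
  move=> dYZ; have [y /(_ dYZ) [yY ydZ]] := dec d.
  have : y \in [seq y <- Y | y^-1 * d \in Z] by rewrite mem_filter ydZ.
  rewrite /f; set L := [seq _ <- _ | _] => yL.
  have : nth 1 L 0 \in L by apply: mem_nth; case: (L) yL.
  by rewrite mem_filter => /andP[].
rewrite -!(size_allpairs pair).
apply: (@size_le_inj _ _ (fun p => (f p.2 * p.1, p.1^-1 * ((f p.2)^-1 * p.2)))).
- by apply: allpairs_uniq => //; [exact: undup_uniq|move=> [? ?] [? ?]].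
- move=> [x d] [x' d'] _ _ /= [e1 e2].
  have ed : d = d'.
    have := congr2 (fun u v => u * v) e1 e2.
    by rewrite -!mulgA !mulVKg.
  by move: e1; rewrite ed => /mulgI ->.
- move=> _ /allpairsP[[x d] [/= xX /fP [fY fZ] ->]]; apply/allpairsP.
  eexists (_, _); split; [| |reflexivity]; first exact: mem_pset.
  by apply: mem_pset; rewrite // mem_iset invgK.
Qed.

End Combinatorics.

(** * Growth of product sets of A and A^-1 *)

Section Words.
Local Open Scope group_scope.
Variables (G : groupType) (A : seq G).
Hypothesis uA : uniq A.
Implicit Types (u v w : seq bool) (e : bool) (x y z : G).

Definition letter e : seq G := if e then A else iset A.
(** The list w is a sign pattern: [word w] is the set of all products with one factor from A for
    each [true] and from A^-1 for each [false], in that order. *)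
Definition word w : seq G := foldr (fun e => pset (letter e)) [:: 1] w.
Definition word_inv w : seq bool := rev (map negb w).

Lemma mem_letter_inv e x : (x^-1 \in letter e) = (x \in letter (~~ e)).
Proof. by case: e; rewrite /= mem_iset ?invgK. Qed.

Lemma uniq_letter e : uniq (letter e).
Proof. by case: e => //=; rewrite map_inj_uniq //; exact: invg_inj. Qed.

Lemma size_letter e : size (letter e) = size A.
Proof. by case: e => //=; rewrite size_map. Qed.

Lemma uniq_word w : uniq (word w).
Proof. by case: w => //= *; exact: undup_uniq. Qed.

Lemma mem_word1 e x : (x \in word [:: e]) = (x \in letter e).
Proof.
apply/psetP/idP => [[y [z [yL]]]|xL]; last first.
  by exists x, 1; rewrite mulg1 inE eqxx.
by rewrite inE => /eqP-> ->; rewrite mulg1.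
Qed.

Lemma word_catP u v z :
  reflect (exists x y, [/\ x \in word u, y \in word v & z = x * y])
          (z \in word (u ++ v)).
Proof.
elim: u z => [|e u IH] z /=.
  apply: (iffP idP) => [zv|[x [y [xu yv ->]]]]; first by exists 1, z; rewrite mul1g inE.
  by move: xu; rewrite inE => /eqP->; rewrite mul1g.
apply: (iffP (psetP _ _ _)) => [[x [y [xe /IH[y1 [y2 [y1u y2v ->]]] ->]]]|].
  by exists (x * y1), y2; rewrite mulgA mem_pset.
move=> [_ [y [/psetP[x1 [x2 [x1e x2u ->]]] yv ->]]].
by exists x1, (x2 * y); rewrite mulgA; split=> //; apply/IH; exists x2, y.
Qed.

Lemma mem_word_cat u v x y : x \in word u -> y \in word v -> x * y \in word (u ++ v).
Proof. by move=> xu yv; apply/word_catP; exists x, y. Qed.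

Lemma word_inv_cat u v : word_inv (u ++ v) = word_inv v ++ word_inv u.
Proof. by rewrite /word_inv map_cat rev_cat. Qed.

Lemma word_invK : involutive word_inv.
Proof. by move=> w; rewrite /word_inv map_rev revK mapK //; exact: negbK. Qed.

Lemma word_inv_mem w x : x \in word w -> x^-1 \in word (word_inv w).
Proof.
elim: w x => [|e w IH] x; first by rewrite !inE => /eqP->; rewrite invg1.
case/psetP=> y [z [ye zw ->]].
rewrite -[e :: w]cat1s word_inv_cat invgM mem_word_cat ?IH //.
by rewrite mem_word1 -mem_letter_inv invgK.
Qed.

Lemma mem_word_inv w x : (x \in word (word_inv w)) = (x^-1 \in word w).
Proof.
by apply/idP/idP => /word_inv_mem; rewrite ?word_invK ?invgK.
Qed.

Lemma size_word_inv w : size (word (word_inv w)) = size (word w).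
Proof.
apply/eqP; rewrite eqn_leq; apply/andP; split.
  apply: (@size_le_inj _ _ (fun x => x^-1)); rewrite ?uniq_word //.
    by move=> x y _ _; exact: invg_inj.
  by move=> x; rewrite mem_word_inv.
apply: (@size_le_inj _ _ (fun x => x^-1)); rewrite ?uniq_word //.
  by move=> x y _ _; exact: invg_inj.
by move=> x; rewrite mem_word_inv invgK.
Qed.

(** Ruzsa's inequality with A or A^-1 as the middle set: a letter is inserted at the cut on one side
    and its inverse on the other. *)
Lemma ruzsa_word u v e :
  (size A * size (word (u ++ v)) <= size (word (u ++ [:: e])) * size (word (~~ e :: v)))%N.
Proof.
have := @ruzsa_triangle G (letter e) (word u) (word v) (uniq_letter e).
rewrite size_letter => H.
apply: leq_trans (leq_trans H _).
  rewrite leq_mul2l; apply/orP; right; apply: uniq_leq_size; first exact: uniq_word.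
  by move=> z /word_catP[x [y [xu yv ->]]]; exact: mem_pset.
apply: leq_mul; apply: uniq_leq_size; rewrite ?undup_uniq //.
  move=> z /psetP[x [y [xu yv ->]]]; apply: mem_word_cat => //.
  by rewrite mem_word1.
move=> z /psetP[x [y [xu yv ->]]]; apply: mem_pset => //.
by rewrite -mem_letter_inv -mem_iset.
Qed.

Lemma size_word_rcons w x e : x \in letter e -> (size (word w) <= size (word (w ++ [:: e])))%N.
Proof.
move=> xe; apply: (@size_le_inj _ _ (fun y => y * x)); rewrite ?uniq_word //.
  by move=> y z _ _ /mulIg.
by move=> y yw; rewrite mem_word_cat ?mem_word1.
Qed.

Let t := size (word [:: true; true; true]).

(** Up to inversion only four patterns occur. AAA is t itself; AAA^-1 and A^-1AA cost one
    application of Ruzsa's inequality and are at most t^2/a. AA^-1A is reduced to A^-1AA by a second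
    application, hence the bound t^3/a^2. *)
Lemma size_word3 w : size w = 3 -> (size A ^ 2 * size (word w) <= t ^ 3)%N.
Proof.
case EA : (size A) => [|a'] sw; first by rewrite mul0n.
have a0 : (0 < size A)%N by rewrite EA.
have [x xA] : exists x, x \in A by case: (A) a0 => // x ? _; exists x; rewrite mem_head.
rewrite -EA; move: a0; set a := size A => a0 {a' EA}.
pose s := fun w => size (word w).
have s1 e : s [:: e] = a.
  rewrite /a -(size_letter e); apply: perm_size; apply: uniq_perm.
  - exact: uniq_word.
  - exact: uniq_letter.
  - by move=> y; exact: mem_word1.
have sinv v : s (word_inv v) = s v by exact: size_word_inv.
have at2 : (s [:: true; true] <= t)%N by exact: (@size_word_rcons [:: true; true] x true).
have at1 : (a <= t)%N.
  by rewrite -(s1 true); apply: leq_trans at2; exact: (@size_word_rcons [:: true] x true).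
have st2 : s [:: false; false] = s [:: true; true] := sinv [:: true; true].
have st3 : s [:: false; false; false] = t := sinv [:: true; true; true].
have H1 : (a * s [:: true; true; false] <= t * t)%N.
  apply: leq_trans (ruzsa_word [:: true; true] [:: false] true) _.
  by apply: leq_mul => //; rewrite -/(s _) st2.
have H2 : (a * s [:: false; true; true] <= t * t)%N.
  apply: leq_trans (ruzsa_word [:: false] [:: true; true] false) _.
  by rewrite mulnC; apply: leq_mul => //; rewrite -/(s _) st2.
have H3 : (a * s [:: true; false; true] <= t * s [:: false; true; true])%N.
  apply: leq_trans (ruzsa_word [:: true] [:: false; true] true) _.
  apply: leq_mul => //=.
  by rewrite -/(s [:: false; false; true]) (sinv [:: false; true; true]).
have {}H3 : (a * a * s [:: true; false; true] <= t * (t * t))%N.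
  rewrite -mulnA; apply: leq_trans (leq_mul (leqnn a) H3) _.
  by rewrite mulnCA leq_mul.
have i1 : s [:: true; false; false] = s [:: true; true; false] := sinv [:: true; true; false].
have i2 : s [:: false; false; true] = s [:: false; true; true] := sinv [:: false; true; true].
have i3 : s [:: false; true; false] = s [:: true; false; true] := sinv [:: true; false; true].
rewrite -/(s w) -mulnn !expnS expn0 muln1.
case: w sw => [|e1 [|e2 [|e3 [|? ?]]]] // _.
case: e1; case: e2; case: e3; rewrite ?i1 ?i2 ?i3 ?st3 //.
- by rewrite mulnC !leq_mul.
- by rewrite -mulnA leq_mul.
- by rewrite -mulnA leq_mul.
- by rewrite -mulnA leq_mul.
- by rewrite -mulnA leq_mul.
- by rewrite mulnC !leq_mul.
Qed.

(** Cutting after two letters bounds a long pattern by a pattern of length three times one that is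
    shorter by a letter, divided by a. Each extra letter thus costs a factor (t/a)^3. *)
Lemma size_word_bound n w : size w = (n + 3)%N ->
  (size A ^ (3 * n + 2) * size (word w) <= t ^ (3 * n + 3))%N.
Proof.
elim: n w => [|n IH] w; first by rewrite !muln0 add0n; exact: size_word3.
case: w => [|e1 [|e2 v]]; [by rewrite addnS|by rewrite !addnS|].
move=> sv.
have sv' : size (true :: v) = (n + 3)%N by move: sv => /=; lia.
have H := IH _ sv'.
have R := ruzsa_word [:: e1; e2] v false.
have T := @size_word3 [:: e1; e2; false] erefl.
rewrite [X in (size A ^ X * _)%N](_ : _ = 2 + 1 + (3 * n + 2))%N; last by lia.
rewrite [X in (t ^ X)%N](_ : _ = 3 + (3 * n + 3))%N; last by lia.
rewrite (expnD t 3) (expnD _ (2 + 1)%N) (expnD _ 2) expn1.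
apply: leq_trans (leq_mul T H).
have aux (p q a x y z : nat) : (a * x <= y * z -> p * a * q * x <= p * y * (q * z))%N.
  by move=> h; rewrite -!mulnA (mulnCA a) (mulnCA y) !(leq_mul (leqnn _)).
exact: (aux _ _ _ _ _ _ R).
Qed.

End Words.

(** * Two by two matrices *)

Import GRing.Theory.

Section Matrix2.
Local Open Scope ring_scope.
Variable K : fieldType.
Implicit Types A B C m : 'M[K]_2.

Lemma ord2P (i : 'I_2) : i = 0 \/ i = 1.
Proof. by case: i => [[|[|//]] ?]; [left|right]; exact: val_inj. Qed.

Lemma mx2P A B : A 0 0 = B 0 0 -> A 0 1 = B 0 1 -> A 1 0 = B 1 0 -> A 1 1 = B 1 1 -> A = B.
Proof.
move=> ? ? ? ?; apply/matrixP => i j.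
by case: (ord2P i) => ->; case: (ord2P j) => ->.
Qed.

Lemma mulmx2E A B i j : (A * B) i j = A i 0 * B 0 j + A i 1 * B 1 j.
Proof.
rewrite mxE big_ord_recl big_ord1; congr (_ + A i _ * B _ j); exact: val_inj.
Qed.

Lemma scalarmx2E (c : K) :
  ((c%:M : 'M_2) 0 0 = c) * ((c%:M : 'M_2) 0 1 = 0) *
  ((c%:M : 'M_2) 1 0 = 0) * ((c%:M : 'M_2) 1 1 = c).
Proof. by rewrite !mxE. Qed.

Lemma addmx2E A B i j : (A + B) i j = A i j + B i j. Proof. by rewrite mxE. Qed.
Lemma oppmx2E A i j : (- A) i j = - A i j. Proof. by rewrite mxE. Qed.
Lemma scalemx2E c A i j : (c *: A) i j = c * A i j. Proof. by rewrite mxE. Qed.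
Lemma zeromx2E i j : (0 : 'M[K]_2) i j = 0. Proof. by rewrite mxE. Qed.
Lemma onemx2E :
  ((1 : 'M[K]_2) 0 0 = 1) * ((1 : 'M[K]_2) 0 1 = 0) *
  ((1 : 'M[K]_2) 1 0 = 0) * ((1 : 'M[K]_2) 1 1 = 1).
Proof. by rewrite !mxE. Qed.

Definition mx2E :=
  (mulmx2E, addmx2E, oppmx2E, scalemx2E, zeromx2E, onemx2E, scalarmx2E).

Lemma det2E A : \det A = A 0 0 * A 1 1 - A 0 1 * A 1 0.
Proof.
rewrite (expand_det_row _ 0) big_ord_recl big_ord1 /cofactor !det_mx11 !mxE /=.
rewrite expr0 mul1r expr1 mulN1r mulrN.
by congr (_ * A _ _ - A _ _ * A _ _); exact: val_inj.
Qed.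

Lemma tr2E A : \tr A = A 0 0 + A 1 1.
Proof. by rewrite /mxtrace big_ord_recl big_ord1; congr (_ + A _ _); exact: val_inj. Qed.

Lemma is_scalar2E A :
  is_scalar_mx A = [&& A 0 1 == 0, A 1 0 == 0 & A 0 0 == A 1 1].
Proof.
apply/is_scalar_mxP/and3P => [[c ->]|[/eqP a /eqP b /eqP c]].
  by rewrite !scalarmx2E !eqxx.
by exists (A 0 0); apply: mx2P; rewrite !scalarmx2E // -c.
Qed.

(** The equations are the vanishing of the cross product of the vectors (A 0 1, A 1 0, A 0 0 - A 1
    1) and (B 0 1, B 1 0, B 0 0 - B 1 1), which describe the matrices modulo scalars. *)
Lemma comm2E A B : GRing.comm A B <->
  [/\ A 0 1 * B 1 0 = A 1 0 * B 0 1,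
      A 0 1 * (B 0 0 - B 1 1) = B 0 1 * (A 0 0 - A 1 1) &
      A 1 0 * (B 0 0 - B 1 1) = B 1 0 * (A 0 0 - A 1 1)].
Proof.
split=> [AB|[h1 h2 h3]].
  have e00 : (A * B) 0 0 = (B * A) 0 0 by rewrite AB.
  have e01 : (A * B) 0 1 = (B * A) 0 1 by rewrite AB.
  have e10 : (A * B) 1 0 = (B * A) 1 0 by rewrite AB.
  move: e00 e01 e10; rewrite !mulmx2E => e00 e01 e10.
  split; apply/eqP; rewrite -subr_eq0; apply/eqP.
  - by move/eqP: e00; rewrite -subr_eq0 => /eqP <-; ring.
  - by move/eqP: e01; rewrite eq_sym -subr_eq0 => /eqP <-; ring.
  - by move/eqP: e10; rewrite -subr_eq0 => /eqP <-; ring.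
apply: mx2P; rewrite !mulmx2E; apply/eqP; rewrite -subr_eq0; apply/eqP.
- by move/eqP: h1; rewrite -subr_eq0 => /eqP <-; ring.
- by move/eqP: h2; rewrite eq_sym -subr_eq0 => /eqP <-; ring.
- by move/eqP: h3; rewrite -subr_eq0 => /eqP <-; ring.
- by move/eqP: h1; rewrite eq_sym -subr_eq0 => /eqP <-; ring.
Qed.

(** The vector that [comm2E] attaches to A is nonzero, and those of B and C are multiples of it. So
    the centralizer of a non-scalar matrix is commutative. *)
Lemma comm2_trans A B C :
  ~~ is_scalar_mx A -> GRing.comm A B -> GRing.comm A C -> GRing.comm B C.
Proof.
move=> nA /comm2E[b1 b2 b3] /comm2E[c1 c2 c3]; apply/comm2E; move: nA.
rewrite is_scalar2E -subr_eq0 -(subr_eq0 (A 0 0)) subr0.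
move: b1 b2 b3 c1 c2 c3.
move: (A 0 0 - A 1 1) (B 0 0 - B 1 1) (C 0 0 - C 1 1) => a b c.
move: (A 0 1) (A 1 0) (B 0 1) (B 1 0) (C 0 1) (C 1 0) => p q p1 q1 p2 q2.
move=> b1 b2 b3 c1 c2 c3.
have [p0|p0 _] := eqVneq p 0; last first.
  have -> : q1 = q * p1 / p by apply: (mulfI p0); rewrite b1; field.
  have -> : q2 = q * p2 / p by apply: (mulfI p0); rewrite c1; field.
  have -> : b = p1 * a / p by apply: (mulfI p0); rewrite b2; field.
  have -> : c = p2 * a / p by apply: (mulfI p0); rewrite c2; field.
  by split; field.
have [q0|q0 _] := eqVneq q 0; last first.
  have -> : p1 = p * q1 / q by apply: (mulfI q0); rewrite -b1; field.
  have -> : p2 = p * q2 / q by apply: (mulfI q0); rewrite -c1; field.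
  have -> : b = q1 * a / q by apply: (mulfI q0); rewrite b3; field.
  have -> : c = q2 * a / q by apply: (mulfI q0); rewrite c3; field.
  by split; field.
move=> /= a0; subst p q; move/eqP: b2; move/eqP: b3; move/eqP: c2; move/eqP: c3.
rewrite !mul0r ![0 == _]eq_sym !mulf_eq0 (negbTE a0) !orbF.
by move=> /eqP-> /eqP-> /eqP-> /eqP->; rewrite !(mul0r, mulr0).
Qed.

Lemma conj2_scalar A B : B \is a GRing.unit ->
  is_scalar_mx (B * A * B^-1) = is_scalar_mx A.
Proof.
move=> uB; apply/is_scalar_mxP/is_scalar_mxP => [[c H]|[c ->]]; exists c.
  have -> : A = B^-1 * (B * A * B^-1) * B by rewrite -!mulrA mulVr // mulr1 mulKr.
  by rewrite H -scalemx1 -scalerAr -scalerAl mulr1 mulVr.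
by rewrite -scalemx1 -scalerAr mulr1 -scalerAl mulrV.
Qed.

Lemma conj2_comm A B C : B \is a GRing.unit ->
  GRing.comm A C -> GRing.comm (B * A * B^-1) (B * C * B^-1).
Proof.
move=> uB AC; rewrite /GRing.comm !mulrA !(mulrVK uB).
by rewrite -(mulrA B) AC mulrA.
Qed.

(* [w] represents the line spanned by its traceless part in sl_2. *)
Definition line_fixed (w B : 'M[K]_2) := GRing.comm w (B * w * B^-1).

(** The product of the column (p, q) and the row (-q, p), a square-zero matrix whose image and
    kernel are spanned by (p, q) when this vector is nonzero. *)
Definition nilpotent_line (p q : K) : 'M[K]_2 :=
  \matrix_(i, j) (if i == 0 then (if j == 0 then - (p * q) else p * p)
                  else (if j == 0 then - (q * q) else p * q)).

Lemma nilpotent_line_nonscalar p q :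
  ~~ ((p == 0) && (q == 0)) -> ~~ is_scalar_mx (nilpotent_line p q).
Proof.
apply: contra; rewrite is_scalar2E !mxE /= oppr_eq0 !mulf_eq0 !orbb.
by case/and3P=> -> ->.
Qed.

(** As B has determinant 1 and multiplies the column (p, q) by c, it multiplies the row (-q, p) from
    the right by c^-1. Hence conjugation by B multiplies the nilpotent matrix by c^2. *)
Lemma eigenvector_line_fixed B (p q c : K) : \det B = 1 ->
  B 0 0 * p + B 0 1 * q = c * p -> B 1 0 * p + B 1 1 * q = c * q ->
  line_fixed (nilpotent_line p q) B.
Proof.
move=> dB e1 e2; have uB : B \is a GRing.unit.
  by rewrite unitmxE dB unitr1.
set w := nilpotent_line p q.
have H : B * w = (c ^+ 2) *: (w * B).
  (* [f1] and [f2] apply the adjugate of B, which is its inverse, to the eigenvector equation; no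
     division by c occurs. *)
  have f1 : p = c * (B 1 1 * p - B 0 1 * q).
    have -> : c * (B 1 1 * p - B 0 1 * q) = B 1 1 * (c * p) - B 0 1 * (c * q) by ring.
    by rewrite -e1 -e2 -[LHS]mul1r -dB det2E; ring.
  have f2 : q = c * (B 0 0 * q - B 1 0 * p).
    have -> : c * (B 0 0 * q - B 1 0 * p) = B 0 0 * (c * q) - B 1 0 * (c * p) by ring.
    by rewrite -e1 -e2 -[LHS]mul1r -dB det2E; ring.
  apply: mx2P; rewrite !mx2E !mxE /=.
  - transitivity (- (B 0 0 * p + B 0 1 * q) * q); first by ring.
    by rewrite e1 [X in _ * X = _]f2; ring.
  - transitivity ((B 0 0 * p + B 0 1 * q) * p); first by ring.
    by rewrite e1 [X in _ * X = _]f1; ring.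
  - transitivity (- (B 1 0 * p + B 1 1 * q) * q); first by ring.
    by rewrite e2 [X in _ * X = _]f2; ring.
  - transitivity ((B 1 0 * p + B 1 1 * q) * p); first by ring.
    by rewrite e2 [X in _ * X = _]f1; ring.
by rewrite /line_fixed H -!scalerAl mulrK // /GRing.comm -scalerAr -scalerAl.
Qed.

(** The first nonzero column of m is taken as (p, q); the other column is a multiple of it. *)
Lemma rank1_factor m : m != 0 -> \det m = 0 ->
  exists p q l0 l1 : K, [/\ ~~ ((p == 0) && (q == 0)), ~~ ((l0 == 0) && (l1 == 0)),
    m 0 0 = p * l0, m 0 1 = p * l1 & m 1 0 = q * l0 /\ m 1 1 = q * l1].
Proof.
move=> m0; rewrite det2E => /eqP; rewrite subr_eq0 => /eqP dm.
have [p0|p0] := eqVneq (m 0 0) 0; last first.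
  exists (m 0 0), (m 1 0), 1, (m 0 1 / m 0 0); rewrite (negbTE p0) oner_eq0 !mulr1 /=.
  split=> //; first by field.
  by split=> //; apply: (mulfI p0); rewrite dm; field.
have [q0|q0] := eqVneq (m 1 0) 0; last first.
  exists (m 0 0), (m 1 0), 1, (m 1 1 / m 1 0); rewrite (negbTE q0) oner_eq0 !mulr1 andbF /=.
  split=> //; last by split=> //; field.
  by apply: (mulIf q0); rewrite -dm; field.
exists (m 0 1), (m 1 1), 0, 1; rewrite oner_eq0 !mulr1 !mulr0 andbF; split=> //.
apply: contra m0 => /andP[/eqP a /eqP b]; apply/eqP.
by apply: mx2P; rewrite zeromx2E.
Qed.

(** The image of m z lies in the image of m, spanned by (p, q), so B sends (p, q) to a multiple of
    itself. A nonzero coordinate of (l0, l1) allows the eigenvalue to be read off. *)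
Lemma rank1_line_fixed m B z (c : K) p q l0 l1 : \det B = 1 ->
  ~~ ((l0 == 0) && (l1 == 0)) ->
  m 0 0 = p * l0 -> m 0 1 = p * l1 -> m 1 0 = q * l0 -> m 1 1 = q * l1 ->
  B * m = c *: (m * z) -> line_fixed (nilpotent_line p q) B.
Proof.
move=> dB l m00 m01 m10 m11 H.
have e i j : (B * m) i j = (c *: (m * z)) i j by rewrite H.
have := e 0 0; have := e 0 1; have := e 1 0; have := e 1 1.
rewrite !mx2E m00 m01 m10 m11 => h11 h10 h01 h00.
have [l00|l00] := eqVneq l0 0; last first.
  apply: (@eigenvector_line_fixed _ _ _ (c * (l0 * z 0 0 + l1 * z 1 0) / l0)) => //.
    by apply: (mulIf l00); transitivity (B 0 0 * (p * l0) + B 0 1 * (q * l0)); [ring|rewrite h00; field].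
  by apply: (mulIf l00); transitivity (B 1 0 * (p * l0) + B 1 1 * (q * l0)); [ring|rewrite h10; field].
move: l; rewrite l00 eqxx /= => l1n.
apply: (@eigenvector_line_fixed _ _ _ (c * (l0 * z 0 1 + l1 * z 1 1) / l1)) => //.
  by apply: (mulIf l1n); transitivity (B 0 0 * (p * l1) + B 0 1 * (q * l1)); [ring|rewrite h01; field].
by apply: (mulIf l1n); transitivity (B 1 0 * (p * l1) + B 1 1 * (q * l1)); [ring|rewrite h11; field].
Qed.

End Matrix2.

(** * Linear subspaces of the space of matrices *)

Section Span.
Local Open Scope ring_scope.
Variable K : fieldType.
Implicit Types X Y Z m : 'M[K]_2.

(** Coordinates in which the trace form tr(m X) is a dot product with the coordinates of the
    transpose of m, so that rank arguments apply. *)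
Definition flatten2 X : 'rV[K]_4 := \row_k [:: X 0 0; X 0 1; X 1 0; X 1 1]`_k.

Lemma flatten2_tr m X : \tr (m * X) = (flatten2 X *m (flatten2 m^T)^T) 0 0.
Proof. by rewrite tr2E !mulmx2E mxE !big_ord_recl big_ord0 !mxE /=; ring. Qed.

Lemma flatten2_eq0 X : flatten2 X = 0 -> X = 0.
Proof.
move=> /rowP H; apply: mx2P; rewrite mxE.
- by have := H 0; rewrite !mxE.
- by have := H 1; rewrite !mxE.
- by have := H (inord 2); rewrite !mxE !inordK.
- by have := H (inord 3); rewrite !mxE !inordK.
Qed.

Lemma flatten2D X Y : flatten2 (X + Y) = flatten2 X + flatten2 Y.
Proof.
apply/rowP => k; rewrite !mxE.
by case: k => [[|[|[|[|k]]]] //= ?]; rewrite !mxE.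
Qed.

Lemma flatten2Z c X : flatten2 (c *: X) = c *: flatten2 X.
Proof.
apply/rowP => k; rewrite !mxE.
by case: k => [[|[|[|[|k]]]] //= ?]; rewrite !mxE.
Qed.

Lemma row_free_dependent n (U : 'M[K]_(n, 4)) :
  ~~ row_free U -> exists2 v : 'rV_n, v != 0 & v *m U = 0.
Proof.
by rewrite -kermx_eq0 => /rowV0Pn[v /sub_kermxP vU v0]; exists v.
Qed.

(* A two-dimensional space of matrices cannot contain three independent ones. *)
Lemma dependent_in_plane m1 m2 X Y Z :
  m1 != 0 -> (forall c, m2 != c *: m1) ->
  (forall T, T \in [:: X; Y; Z] -> \tr (m1 * T) = 0 /\ \tr (m2 * T) = 0) ->
  exists a b c : K, [/\ ~~ [&& a == 0, b == 0 & c == 0] &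
    a *: X + b *: Y + c *: Z = 0].
Proof.
move=> m10 m12 H.
pose U : 'M[K]_(3, 4) := \matrix_i flatten2 [:: X; Y; Z]`_i.
pose V : 'M[K]_(2, 4) := \matrix_i flatten2 [:: m1^T; m2^T]`_i.
have UV : U *m V^T = 0.
  apply/matrixP => i j; rewrite [RHS]mxE.
  have -> : (U *m V^T) i j = \tr ([:: m1; m2]`_j * [:: X; Y; Z]`_i).
    rewrite flatten2_tr !mxE; apply: eq_bigr => k _.
    by case: j => [[|[|//]] ?]; rewrite !mxE /= ?mxE.
  case/H: (mem_nth 0 (ltn_ord i : (i < size [:: X; Y; Z])%N)).
  by case: j => [[|[|//]] ?].
(* The rows of U are orthogonal to those of V. Since V has rank 2, this leaves rank at most 2 for
   the three rows of U. *)
have : (\rank U + \rank V^T <= 4)%N by exact: mulmx0_rank_max.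
rewrite mxrank_tr => rk.
case: (boolP (row_free V)) => [|/row_free_dependent[v v0]]; last first.
  rewrite mulmx_sum_row !big_ord_recl big_ord0 !rowK addr0 /= -!flatten2Z -flatten2D.
  move=> /flatten2_eq0 /(congr1 trmx); rewrite linearD !linearZ /= !trmxK trmx0.
  set x := v 0 _; set y := v 0 _ => E; exfalso.
  have [y0|y0] := eqVneq y 0.
    move: E; rewrite y0 scale0r addr0 => /eqP; rewrite scaler_eq0 (negbTE m10) orbF => /eqP x0.
    case/negP: v0; apply/eqP/rowP => k; rewrite mxE.
    by case: (ord2P k) => ->; [rewrite -[RHS]x0|rewrite -[RHS]y0]; congr (v _ _); exact: val_inj.
  case/negP: (m12 (- (x / y))); apply/eqP; apply: (scalerI y0).
  by rewrite scalerA mulrN mulrC mulfVK // scaleNr; apply/eqP; rewrite -addr_eq0 addrC E.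
rewrite /row_free => /eqP rV.
have /row_free_dependent[v v0] : ~~ row_free U.
  by apply/negP; rewrite /row_free => /eqP rU; move: rk; rewrite rU rV.
rewrite mulmx_sum_row !big_ord_recl big_ord0 !rowK addr0 /= -!flatten2Z -!flatten2D.
move/flatten2_eq0; rewrite addrA => E.
eexists _, _, _; split; last exact: E.
apply: contra v0 => /and3P[/eqP a /eqP b /eqP c].
apply/eqP/rowP => k; rewrite mxE.
case: k => [[|[|[|//]]] ?]; [rewrite -[RHS]a|rewrite -[RHS]b|rewrite -[RHS]c];
  by congr (v _ _); exact: val_inj.
Qed.

(** Multiplying a linear relation between X, Y, Z by X^-1 puts X^-1 Z in the span of 1 and X^-1 Y.
    The coefficient of Z is nonzero, as otherwise X^-1 Y would be scalar. *)
Lemma comm_in_plane m1 m2 X Y Z :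
  m1 != 0 -> (forall c, m2 != c *: m1) -> X \is a GRing.unit ->
  (forall T, T \in [:: X; Y; Z] -> \tr (m1 * T) = 0 /\ \tr (m2 * T) = 0) ->
  ~~ is_scalar_mx (X^-1 * Y) -> GRing.comm (X^-1 * Y) (X^-1 * Z).
Proof.
move=> m10 m12 uX H nXY; have [a [b [c [abc E]]]] := dependent_in_plane m10 m12 H.
have {}E : a%:M + b *: (X^-1 * Y) + c *: (X^-1 * Z) = 0.
  by rewrite -[RHS](mulr0 X^-1) -E !mulrDr -!scalerAr mulVr // scalemx1.
have [c0|c0] := eqVneq c 0; last first.
  have -> : X^-1 * Z = - (a / c)%:M - (b / c) *: (X^-1 * Y).
    apply: (scalerI c0); rewrite scalerBr scalerN scalerA mulrCA mulfV // mulr1.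
    rewrite scale_scalar_mx mulrCA mulfV // mulr1.
    by apply/eqP; rewrite -opprD -addr_eq0 addrC E.
  apply: GRing.commrB; last by rewrite /GRing.comm -scalerAr -scalerAl.
  by apply: commrN; exact: scalar_mxC.
move: E; rewrite c0 scale0r addr0 => E; exfalso.
have [b0|b0] := eqVneq b 0.
  move: E abc; rewrite b0 c0 scale0r addr0 !eqxx !andbT => /matrixP/(_ 0 0).
  by rewrite !mxE eqxx => /eqP->.
case/negP: nXY; apply/is_scalar_mxP; exists (- (a / b)).
apply: (scalerI b0); rewrite scale_scalar_mx mulrN mulrC mulfVK // raddfN.
by apply/eqP; rewrite -addr_eq0 addrC E.
Qed.

End Span.

(** * The group SL_2 over a field *)

Section SL2.
Local Open Scope ring_scope.
Variable K : fieldType.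

Definition SL2 : predArgType := {m : 'M[K]_2 | \det m == 1}.
HB.instance Definition _ := Choice.on SL2.
HB.instance Definition _ := SubType.on SL2.

Coercion mx_of_SL2 (x : SL2) : 'M[K]_2 := sval x.

Lemma SL2_det (x : SL2) : \det x = 1. Proof. exact/eqP/(svalP x). Qed.

Lemma SL2_inj (x y : SL2) : x = y :> 'M[K]_2 -> x = y.
Proof. by move=> H; exact: val_inj. Qed.

Lemma SL2_unit (x : SL2) : (x : 'M[K]_2) \is a GRing.unit.
Proof. by rewrite unitmxE SL2_det unitr1. Qed.

Fact SL2_mul_subproof (x y : SL2) : \det ((x : 'M[K]_2) * y) == 1.
Proof. by rewrite det_mulmx !SL2_det mulr1. Qed.
Fact SL2_inv_subproof (x : SL2) : \det ((x : 'M[K]_2)^-1) == 1.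
Proof. by rewrite det_inv SL2_det invr1. Qed.
Fact SL2_one_subproof : \det (1 : 'M[K]_2) == 1.
Proof. by rewrite det1. Qed.

Definition SL2_mul (x y : SL2) : SL2 := exist (fun m : 'M[K]_2 => \det m == 1) _ (SL2_mul_subproof x y).
Definition SL2_inv (x : SL2) : SL2 := exist (fun m : 'M[K]_2 => \det m == 1) _ (SL2_inv_subproof x).
Definition SL2_one : SL2 := exist (fun m : 'M[K]_2 => \det m == 1) _ (SL2_one_subproof).

Fact SL2_mulA : associative SL2_mul.
Proof. by move=> x y z; apply: SL2_inj; rewrite /= mulrA. Qed.
Fact SL2_mul1 : left_id SL2_one SL2_mul.
Proof. by move=> x; apply: SL2_inj; rewrite /= mul1r. Qed.
Fact SL2_1mul : right_id SL2_one SL2_mul.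
Proof. by move=> x; apply: SL2_inj; rewrite /= mulr1. Qed.
Fact SL2_mulV : left_inverse SL2_one SL2_inv SL2_mul.
Proof. by move=> x; apply: SL2_inj; rewrite /= mulVr // SL2_unit. Qed.
Fact SL2_Vmul : right_inverse SL2_one SL2_inv SL2_mul.
Proof. by move=> x; apply: SL2_inj; rewrite /= mulrV // SL2_unit. Qed.

HB.instance Definition _ := isGroup.Build SL2 SL2_mulA SL2_mul1 SL2_1mul SL2_mulV SL2_Vmul.

Lemma SL2_mulE (x y : SL2) : mx_of_SL2 (x * y)%g = (x : 'M[K]_2) * y.
Proof. by []. Qed.
Lemma SL2_invE (x : SL2) : mx_of_SL2 (x^-1)%g = (x : 'M[K]_2)^-1.
Proof. by []. Qed.

Lemma SL2_commE (x y : SL2) : commute x y <-> GRing.comm (x : 'M[K]_2) y.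
Proof.
split=> [|H]; first by move=> /(congr1 mx_of_SL2).
exact: SL2_inj.
Qed.

Definition nonscalar (x : SL2) := ~~ is_scalar_mx (x : 'M[K]_2).

Fact SL2_opp1_subproof : \det (- 1 : 'M[K]_2) == 1.
Proof. by rewrite det2E !oppmx2E !onemx2E; apply/eqP; ring. Qed.
Definition SL2_opp1 : SL2 := exist (fun m : 'M[K]_2 => \det m == 1) _ (SL2_opp1_subproof).

Lemma SL2_scalarP (x : SL2) : ~~ nonscalar x -> x = 1%g \/ x = SL2_opp1.
Proof.
rewrite negbK => /is_scalar_mxP[c xc].
have : c ^+ 2 == 1 by rewrite -(SL2_det x) xc det_scalar.
rewrite sqrf_eq1 => /orP[]/eqP cE; [left|right]; apply: SL2_inj; rewrite xc cE //.
by rewrite raddfN.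
Qed.

Lemma commute_nonscalar (x y z : SL2) :
  nonscalar x -> commute x y -> commute x z -> commute y z.
Proof. by move=> nx /SL2_commE h /SL2_commE h'; apply/SL2_commE; exact: comm2_trans nx h h'. Qed.

Lemma nonscalar_conj (x y : SL2) : nonscalar (y * x * y^-1)%g = nonscalar x.
Proof. by rewrite /nonscalar SL2_mulE SL2_mulE SL2_invE conj2_scalar ?SL2_unit. Qed.

End SL2.

(** * Dense subsets of conjugacy classes *)

Section RichCentralizers.
Variables (K : fieldType) (A : seq (SL2 K)).
Hypothesis uA : uniq A.
Implicit Types (X : seq (SL2 K)) (b g s t u x y z : SL2 K) (m w : 'M[K]_2).
Local Open Scope group_scope.

Definition invariant_line :=
  exists2 w, ~~ is_scalar_mx w & forall b, b \in A -> line_fixed w b.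

Lemma line_fixedE u b : line_fixed u b <-> commute u (b * u * b^-1).
Proof. by split=> [h|/SL2_commE]; [apply/SL2_commE|]. Qed.

(** Scalars of determinant 1 are 1 and -1, so elements with scalar ratio to x number at most two. *)
Lemma nonscalar_ratio X : uniq X -> (2 < size X)%N ->
  exists x y, [/\ x \in X, y \in X & nonscalar (x^-1 * y)].
Proof.
case: X => // x X uX sX; exists x.
case: (boolP (has (fun y => nonscalar (x^-1 * y)) (x :: X))) => [/hasP[y yX ny]|].
  by exists y; rewrite mem_head.
rewrite -all_predC => /allP /= H.
have : (size (x :: X) <= size [:: x; (x * SL2_opp1 K)%g])%N.
  apply: uniq_leq_size => // y /H /SL2_scalarP[] E.
    by rewrite -[y](mulVKg x) E mulg1 mem_head.
  by rewrite -[y](mulVKg x) E !inE eqxx orbT.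
by rewrite leqNgt sX.
Qed.

Variable wS : seq bool.
(** For s, t in [word A wS] and b in A, the element s b t^-1 belongs to this set, so N is the size
    of W in [popular_translate]. *)
Let N := size (word A (wS ++ true :: word_inv wS)).

Lemma popular_in_word X b (E : seq (SL2 K)) :
  uniq X -> {subset X <= word A wS} -> b \in A -> (size E < size X)%N ->
  exists2 z, z \notin E &
    (size X * (size X - size E) <= N * size [seq s <- X | (z^-1 * s * b)%g \in X])%N.
Proof.
move=> uX XS bA EX; apply: popular_translate => // s t sX tX.
rewrite -mulgA; apply: mem_word_cat; first exact: XS.
by apply: mem_pset => //; rewrite mem_word_inv invgK; exact: XS.
Qed.

(** All ratios of elements of X commute with v = p^-1 q, because X spans at most a plane. For b in A
    a popular translate gives a non-scalar ratio r of elements of X for which b^-1 r b is again a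
    ratio. So r commutes with v and with b v b^-1, which therefore commute. *)
Lemma plane_invariant_line X m1 m2 :
  uniq X -> {subset X <= word A wS} ->
  m1 != 0%R -> (forall c, m2 != (c *: m1)%R) ->
  (forall s, s \in X -> (\tr (m1 * (s : 'M[K]_2)) = 0)%R /\ (\tr (m2 * (s : 'M[K]_2)) = 0)%R) ->
  (2 < size X)%N -> (forall n, size X * size X <= N * n -> 2 < n)%N ->
  invariant_line.
Proof.
move=> uX XS m10 m12 trX sX big.
have [p [q [pX qX npq]]] := nonscalar_ratio uX sX.
have comX x y : x \in X -> y \in X -> commute (p^-1 * q) (x^-1 * y).
  have H y' : y' \in X -> commute (p^-1 * q) (p^-1 * y').
    move=> y'X; apply/SL2_commE; rewrite !SL2_mulE SL2_invE.
    apply: (comm_in_plane m10 m12); first exact: SL2_unit.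
      by move=> T; rewrite !inE => /or3P[]/eqP->; exact: trX.
    exact: npq.
  move=> xX yX; rewrite (_ : x^-1 * y = (p^-1 * x)^-1 * (p^-1 * y)); last first.
    by rewrite invgM invgK -mulgA mulVKg.
  by apply: commuteM; [apply: commuteV|]; exact: H.
exists (p^-1 * q : SL2 K) => // b bA; apply/line_fixedE.
have [|z _ Hz] := @popular_in_word X b [::] uX XS bA; first exact: leq_trans sX.
move: Hz; rewrite subn0 => /big.
set Y := [seq _ <- _ | _] => sY.
have [s1 [s2 []]] := nonscalar_ratio (filter_uniq _ uX) sY.
rewrite !mem_filter => /andP[t1X s1X] /andP[t2X s2X] ns.
set v : SL2 K := p^-1 * q; set r : SL2 K := s1^-1 * s2.
have c1 : commute v r by exact: comX.
have c2 : commute v (b^-1 * r * b).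
  rewrite (_ : b^-1 * r * b = (z^-1 * s1 * b)^-1 * (z^-1 * s2 * b)); first exact: comX.
  by rewrite /r !invgM invgK -!mulgA; congr (_ * (_ * _)); rewrite mulVKg.
have c3 : commute (b * v * b^-1) r.
  have -> : r = b * (b^-1 * r * b) * b^-1 by rewrite -!mulgA mulgV mulg1 mulVKg.
  apply/SL2_commE; apply: conj2_comm; [exact: SL2_unit|exact/SL2_commE].
exact: (commute_nonscalar ns (commute_sym c1) (commute_sym c3)).
Qed.

(** Intersecting X with a translate adds the equation tr(b m z^-1 s) = 0. If it is independent of
    the first one, the planar case applies. Otherwise b m is a multiple of m z; for singular m this
    makes the image of m a common eigenline, and for invertible m it restricts z to two values,
    which can be excluded beforehand. *)
Lemma hyperplane_invariant_line X m : A != [::] ->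
  uniq X -> {subset X <= word A wS} -> m != 0%R ->
  (forall s, s \in X -> (\tr (m * (s : 'M[K]_2)) = 0)%R) ->
  (2 < size X)%N ->
  (forall n2, (size X * (size X - 2) <= N * n2)%N -> (2 < n2)%N /\
    forall n3, (n2 * n2 <= N * n3)%N -> (2 < n3)%N) ->
  invariant_line.
Proof.
move=> A0 uX XS m0 trX sX big.
have step b E : b \in A -> (size E <= 2)%N -> invariant_line \/
    exists c z, z \notin E /\ ((b : 'M[K]_2) * m = c *: (m * (z : 'M[K]_2)))%R.
  move=> bA sE.
  have [|z zE Hz] := @popular_in_word X b E uX XS bA; first exact: leq_ltn_trans sX.
  have {}Hz : (size X * (size X - 2) <= N * size [seq s <- X | (z^-1 * s * b)%g \in X])%N.
    by apply: leq_trans Hz; rewrite leq_mul2l leq_sub2l ?orbT.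
  have [n2 n3] := big _ Hz.
  set m2 := ((b : 'M[K]_2) * m * mx_of_SL2 (z^-1)%g)%R.
  have [[c Hc]|Hc] : (exists c, m2 = c *: m)%R \/ (forall c, m2 != c *: m)%R.
    have [p [q [i [j mij]]]] : exists p q i j, p = m i j /\ q = m2 i j /\ p != 0%R.
      have [i [j mij]] : exists i j, m i j != 0%R.
        case: (boolP [exists i, exists j, m i j != 0%R]) => [/existsP[i /existsP[j]]|].
          by exists i, j.
        rewrite negb_exists => /forallP H; case/negP: m0; apply/eqP/matrixP => i j.
        have := H i; rewrite negb_exists => /forallP/(_ j); rewrite negbK mxE.
        by move/eqP.
      by exists (m i j), (m2 i j), i, j.
    case: mij => pE [qE p0]; case: (eqVneq m2 ((q / p) *: m)%R) => [e|ne]; first by left; exists (q / p)%R.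
    right=> c; apply: contra ne => /eqP e; apply/eqP; rewrite {1}e; congr (_ *: _)%R.
    by rewrite qE pE e mxE mulfK // -pE.
  - right; exists c, z; split=> //; rewrite scalerAl -Hc /m2 SL2_invE mulrVK //.
    exact: SL2_unit.
  - left; apply: (@plane_invariant_line [seq s <- X | (z^-1 * s * b)%g \in X] m m2) => //.
    + exact: filter_uniq.
    + by move=> s; rewrite mem_filter => /andP[_ /XS].
    + move=> s; rewrite mem_filter => /andP[/trX tr1 /trX tr2]; split=> //.
      rewrite -[RHS]tr1 /m2 -!mulrA [LHS]mxtrace_mulC !mulmxE !SL2_mulE.
      by rewrite !mulrA.
have [b0 b0A] : exists b, b \in A by case: (A) A0 => // b s _; exists b; rewrite mem_head.
have [//|nline] := classic invariant_line.
have [dm|dm] := eqVneq (\det m)%R 0%R.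
  have [p [q [l0 [l1 [pq l01 m00 m01 [m10 m11]]]]]] := rank1_factor m0 dm.
  exists (nilpotent_line p q); first exact: nilpotent_line_nonscalar.
  move=> b bA; have [//|[c [z [_ E]]]] := step b [::] bA isT.
  exact: (rank1_line_fixed (SL2_det b) l01 m00 m01 m10 m11 E).
have um : m \is a GRing.unit by rewrite unitmxE unitfE.
have dz : (\det (m^-1 * (b0 : 'M[K]_2) * m) == 1)%R.
  by rewrite !det_mulmx det_inv SL2_det mulr1 mulVf.
pose z0 : SL2 K := exist (fun x : 'M[K]_2 => \det x == 1)%R _ dz.
(* For invertible [m], only z = +- m^-1 b0 m makes b0 m z^-1 proportional to m. *)
case: (step b0 [:: z0; SL2_opp1 K * z0] b0A isT) => // -[c [z [zE E]]]; exfalso.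
have c2 : (c ^+ 2 == 1)%R.
  have := congr1 determinant E; rewrite detZ !det_mulmx !SL2_det mul1r mulr1.
  by move/eqP; rewrite -{1}[(\det m)%R]mul1r (inj_eq (mulIf dm)) eq_sym.
have Ez : (c *: (z : 'M[K]_2) = z0)%R.
  by rewrite /= -mulrA E -scalerAr mulKr.
case/negP: zE; rewrite !inE; move: c2; rewrite sqrf_eq1.
case/orP => /eqP cE; move: Ez; rewrite cE ?scale1r ?scaleN1r => Ez.
  by rewrite (SL2_inj Ez) eqxx.
suff -> : z = SL2_opp1 K * z0 by rewrite eqxx orbT.
by apply: SL2_inj; rewrite SL2_mulE -Ez /= mulN1r opprK.
Qed.

(* [n0], ..., [n3] are the sizes of the conjugacy class of [g] and of its successive
   intersections with translates.  The first one lies in a hyperplane because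
   tr s = tr (z^-1 s b) on it. *)
Lemma rich_centralizer (w : seq bool) g : wS = true :: w ++ [:: false] ->
  g \in word A w -> nonscalar g ->
  (forall n0, (size A <= 2 * n0)%N -> (2 < n0)%N /\
     forall n1, (n0 * (n0 - 1) <= N * n1)%N -> (2 < n1)%N /\
     forall n2, (n1 * (n1 - 2) <= N * n2)%N -> (2 < n2)%N /\
     forall n3, (n2 * n2 <= N * n3)%N -> (2 < n3)%N) ->
  A != [::] ->
  invariant_line \/
  exists x y, [/\ x \in A, y \in A, nonscalar (x^-1 * y) & commute g (x^-1 * y)].
Proof.
move=> wSE gw ng big A0.
have [|noH] := classic (exists x y,
  [/\ x \in A, y \in A, nonscalar (x^-1 * y) & commute g (x^-1 * y)]); first by right.
left; pose f b := b * g * b^-1; pose S := undup (map f A).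
(* If b and x conjugate g to the same element, then x^-1 b centralizes g, hence is scalar by [noH],
   and b is x or -x. So the conjugacy class contains at least |A|/2 elements. *)
have fibre y : (size [seq b <- A | f b == y] <= 2)%N.
  case: (boolP (has (fun b => f b == y) A)) => [/hasP[x xA /eqP xy]|]; last first.
    by rewrite has_filter negbK => /eqP->.
  apply: (@uniq_leq_size _ _ [:: x; x * SL2_opp1 K]); first exact: filter_uniq.
  move=> b; rewrite mem_filter => /andP[/eqP by_ bA].
  have cb : commute g (x^-1 * b).
    have bg : b * g = x * g * x^-1 * b by rewrite -/(f x) xy -by_ mulgVK.
    by rewrite /commute -[RHS]mulgA bg -!mulgA mulKg.
  have /SL2_scalarP : ~~ nonscalar (x^-1 * b) by apply/negP => nb; case: noH; exists x, b.
  by rewrite !inE => -[] E; rewrite -(mulVKg x b) E ?mulg1 eqxx ?orbT.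
have sS := size_le_fibres fibre; have [S2 {}big] := big _ sS.
have [b0 b0A] : exists b, b \in A by case: (A) A0 => // b s _; exists b; rewrite mem_head.
have SS : {subset S <= word A wS}.
  move=> y; rewrite mem_undup => /mapP[b bA ->]; rewrite wSE /f -mulgA.
  apply: mem_pset => //; apply: mem_word_cat => //.
  by rewrite mem_word1 /= mem_iset invgK.
(* Excluding z = b0 keeps the normal vector b0 z^-1 - 1 of the hyperplane nonzero. *)
have [|z zb Hz] := @popular_in_word S b0 [:: b0] (undup_uniq _) SS b0A; first by apply: ltn_trans S2.
have [sX {}big] := big _ Hz.
apply: (@hyperplane_invariant_line [seq s <- S | (z^-1 * s * b0)%g \in S]
          ((b0 : 'M[K]_2) * mx_of_SL2 (z^-1)%g - 1)%R A0 _ _ _ _ sX big).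
- exact/filter_uniq/undup_uniq.
- by move=> s; rewrite mem_filter => /andP[_ /SS].
- apply: contra zb; rewrite subr_eq0 inE => /eqP E.
  by rewrite -[z]mul1g -[X in X * z](_ : b0 * z^-1 = 1) ?mulgVK //; apply: SL2_inj.
move=> s; rewrite mem_filter => /andP[sS1 sS2].
have trS t : t \in S -> (\tr (t : 'M[K]_2) = \tr (g : 'M[K]_2))%R.
  rewrite mem_undup => /mapP[b bA ->]; rewrite /f SL2_mulE SL2_invE mxtrace_mulC.
  by rewrite !mulmxE SL2_mulE mulKr ?SL2_unit.
have E : (\tr ((b0 : 'M[K]_2) * mx_of_SL2 (z^-1)%g * (s : 'M[K]_2)) =
           \tr (mx_of_SL2 (z^-1 * s * b0)%g))%R.
  by rewrite -mulrA; exact: mxtrace_mulC.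
by rewrite mulrBl mul1r linearB /= E !trS ?subrr.
Qed.

End RichCentralizers.

Import Order.TTheory Num.Theory.

(** * Densities along the chain of intersections *)

Section Counting.
Local Open Scope ring_scope.

(** For x at least 4 the product x (x - 2) is at least x^2/2. Hence density 1/c becomes density 1/(2
    c^2 M) after one intersection. *)
Lemma density_step (F : realFieldType) (a M c x y : F) :
  0 < a -> 0 < M -> 0 < c -> a <= c * x -> 4 <= x ->
  x * (x - 2) <= M * a * y -> a <= 2 * c ^+ 2 * M * y.
Proof.
move=> a0 M0 c0 ax x4 H.
have h1 : x ^+ 2 <= 2 * (M * a * y).
  apply: le_trans (_ : 2 * (x * (x - 2)) <= _); last by rewrite ler_pM2l.
  have : 0 <= x * (x - 4) by rewrite mulr_ge0; lra.
  by rewrite expr2; lra.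
have h2 : a * a <= (2 * c ^+ 2 * M * y) * a.
  apply: le_trans (_ : (c * x) * (c * x) <= _); first by apply: ler_pM => //; lra.
  have -> : c * x * (c * x) = c ^+ 2 * x ^+ 2 by ring.
  have -> : 2 * c ^+ 2 * M * y * a = c ^+ 2 * (2 * (M * a * y)) by ring.
  by rewrite ler_wpM2l // sqr_ge0.
by rewrite ler_pM2r in h2.
Qed.

(** With M = (t/a)^33, N is at most M a. Starting from c = 2 and replacing c by 2 c^2 M, the inverse
    densities are 2, 2^3 M, 2^7 M^3 and 2^15 M^7. The last set has more than 4 elements once a
    exceeds 2^17 M^7, and 231 = 33 times 7. *)
Lemma density_chain (F : realFieldType) (a t N : nat) : (0 < a <= t)%N ->
  (a ^ 32 * N <= t ^ 33)%N -> (2 ^ 17 * t ^ 231 < a ^ 232)%N ->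
  forall n0, (a <= 2 * n0)%N -> (2 < n0)%N /\
  forall n1, (n0 * (n0 - 1) <= N * n1)%N -> (2 < n1)%N /\
  forall n2, (n1 * (n1 - 2) <= N * n2)%N -> (2 < n2)%N /\
  forall n3, (n2 * n2 <= N * n3)%N -> (2 < n3)%N.
Proof.
move=> /andP[a0 at_] HN Hbig.
pose A : F := a%:R; pose T : F := t%:R; pose M := (T / A) ^+ 33.
have A0 : 0 < A by rewrite ltr0n.
have M1 : 1 <= M by rewrite exprn_ege1 // ler_pdivlMr // mul1r ler_nat.
have M0 : 0 < M by apply: lt_le_trans M1.
have NM : N%:R <= M * A.
  have A32 : 0 < A ^+ 32 by exact: exprn_gt0.
  rewrite -(ler_pM2l A32).
  have -> : A ^+ 32 * (M * A) = T ^+ 33.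
    rewrite mulrCA -exprSr /M expr_div_n mulfVK // expf_neq0 //.
    by rewrite gt_eqF.
  by rewrite /A /T -!natrX -natrM ler_nat; exact: HN.
have big : 2 ^+ 17 * M ^+ 7 < A.
  have A231 : 0 < A ^+ 231 by exact: exprn_gt0.
  rewrite -(ltr_pM2r A231).
  have -> : 2 ^+ 17 * M ^+ 7 * A ^+ 231 = 2 ^+ 17 * T ^+ 231.
    by rewrite -mulrA /M -exprM expr_div_n mulfVK // expf_neq0 // gt_eqF.
  by rewrite -exprS /A /T -!natrX -natrM ltr_nat; exact: Hbig.
move: M M1 M0 NM big => M M1 M0 NM big.
have pow k l : (k <= l)%N -> M ^+ k <= M ^+ l.
  by move=> kl; rewrite ler_weXn2l.
have p2 k l : (k <= l)%N -> (2 : F) ^+ k <= 2 ^+ l.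
  by move=> kl; rewrite ler_weXn2l // ler1n.
(* More than 4, although more than 2 is all that is claimed: [density_step] needs at least 4. *)
have bnd k l (n : nat) : (k <= 15)%N -> (l <= 7)%N -> A <= 2 ^+ k * M ^+ l * n%:R -> (4 < n)%N.
  move=> k15 l7 H; rewrite -(ltr_nat F).
  have c0 : 0 < 2 ^+ k * M ^+ l by rewrite mulr_gt0 // exprn_gt0.
  rewrite -(ltr_pM2l c0); apply: lt_le_trans (le_lt_trans _ big) H.
  have -> : (4%:R : F) = 2 ^+ 2 by rewrite -natrX.
  rewrite mulrAC -exprD; apply: ler_pM; [exact: exprn_ge0|exact/exprn_ge0/ltW|apply: p2; lia|exact: pow].
have stp k l n e n' : (k <= 15)%N -> (l <= 7)%N -> (e <= 2)%N ->
    A <= 2 ^+ k * M ^+ l * n%:R -> (n * (n - e) <= N * n')%N ->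
    A <= 2 ^+ (1 + k * 2) * M ^+ (l * 2 + 1) * n'%:R.
  move=> k15 l7 e2 H Hn; have n4 := bnd _ _ _ k15 l7 H.
  have -> : 2 ^+ (1 + k * 2) * M ^+ (l * 2 + 1) = 2 * (2 ^+ k * M ^+ l) ^+ 2 * M.
    by rewrite exprMn -!exprM (exprD 2 1) (exprD M) !expr1 !mulrA.
  apply: (@density_step _ _ _ _ n%:R) => //.
  - by rewrite mulr_gt0 // exprn_gt0.
  - by rewrite ler_nat ltnW.
  - apply: le_trans (_ : N%:R * n'%:R <= _); last by rewrite ler_wpM2r.
    rewrite -natrM; apply: le_trans (_ : (n * (n - e))%:R <= _); last by rewrite ler_nat.
    rewrite natrM natrB; last by lia.
    by rewrite ler_wpM2l // lerD2l lerN2 ler_nat.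
move=> n0 h0.
have H0 : A <= 2 ^+ 1 * M ^+ 0 * n0%:R by rewrite expr0 mulr1 expr1 -natrM ler_nat.
split; first exact: (@leq_trans 5%N 3%N _ isT (bnd 1%N 0%N _ isT isT H0)).
move=> n1 h1; have H1 := stp 1%N 0%N _ 1%N _ isT isT isT H0 h1.
split; first exact: (@leq_trans 5%N 3%N _ isT (bnd 3%N 1%N _ isT isT H1)).
move=> n2 h2; have H2 := stp 3%N 1%N _ 2%N _ isT isT isT H1 h2.
split; first exact: (@leq_trans 5%N 3%N _ isT (bnd 7%N 3%N _ isT isT H2)).
move=> n3; rewrite -{2}[n2]subn0 => h3.
have H3 := stp 7%N 3%N _ 0%N _ isT isT isT H2 h3.
exact: (@leq_trans 5%N 3%N _ isT (bnd 15%N 7%N _ isT isT H3)).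
Qed.

End Counting.

(** * Finite orbits of lines *)

Section Covering.

Definition covered (T : eqType) (P : T -> Prop) := exists s : seq T, forall x, P x -> x \in s.

Lemma covered_by_fibres (T U : eqType) (P : T -> Prop) (R : T -> U -> Prop) (r : seq U) :
  (forall x, P x -> exists2 u, u \in r & R x u) ->
  (forall u, u \in r -> covered (fun x => P x /\ R x u)) -> covered P.
Proof.
elim: r P => [|u r IH] P H1 H2.
  by exists [::] => x /H1[].
have [s1 Hs1] := H2 u (mem_head _ _).
have [s2 Hs2] : covered (fun x => P x /\ ~ R x u).
  apply: IH => [x [Px nR]|v vr].
    have [v] := H1 x Px; rewrite inE => /orP[/eqP->//|vr] Rv; by exists v.
  have [|s Hs] := H2 v; first by rewrite inE vr orbT.
  by exists s => x [[Px _] Rx]; exact: Hs.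
exists (s1 ++ s2) => x Px; rewrite mem_cat.
have [Rx|nR] := classic (R x u); first by rewrite Hs1.
by rewrite Hs2 ?orbT.
Qed.

(** The empty set is covered, so a member may be assumed; it serves as the reference with which the
    other members are compared. *)
Lemma covered_of_base (T : eqType) (P : T -> Prop) :
  (forall y, P y -> covered P) -> covered P.
Proof.
move=> H; have [[y /H]//|nP] := classic (exists y, P y).
by exists [::] => x Px; case: nP; exists x.
Qed.

End Covering.

Section LineOrbits.
Local Open Scope ring_scope.
Variable K : fieldType.
Hypothesis two_neq0 : (2 : K) != 0.
Implicit Types (m v w B : 'M[K]_2) (V : seq 'M[K]_2).

(** Twice the projection to sl_2, which avoids dividing by 2. *)
Definition traceless_part m : 'M[K]_2 := m + m - (\tr m)%:M.

Lemma traceless_partE m :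
  (traceless_part m 0 0 = m 0 0 - m 1 1) * (traceless_part m 0 1 = 2 * m 0 1) *
  (traceless_part m 1 0 = 2 * m 1 0) * (traceless_part m 1 1 = m 1 1 - m 0 0).
Proof. by rewrite /traceless_part !mx2E tr2E; do !split; ring. Qed.

Lemma tr_traceless_part m : \tr (traceless_part m) = 0.
Proof. by rewrite tr2E !traceless_partE; ring. Qed.

Lemma traceless_scalar v : \tr v = 0 -> is_scalar_mx v = (v == 0).
Proof.
move=> v0; apply/idP/eqP => [/is_scalar_mxP[c E]|->]; last first.
  by apply/is_scalar_mxP; exists 0; rewrite raddf0.
move: v0; rewrite E mxtrace_scalar -mulr_natl => /eqP.
by rewrite mulf_eq0 (negbTE two_neq0) => /eqP->; rewrite raddf0.
Qed.

Lemma traceless_part_scalar m : is_scalar_mx (traceless_part m) = is_scalar_mx m.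
Proof.
rewrite !is_scalar2E !traceless_partE !mulf_eq0 (negbTE two_neq0) /=.
congr [&& _, _ & _]; rewrite -subr_eq0 [X in X == 0](_ : _ = 2 * (m 0 0 - m 1 1)); last by ring.
by rewrite mulf_eq0 (negbTE two_neq0) subr_eq0.
Qed.

Lemma comm_traceless_part m B : GRing.comm B m -> GRing.comm B (traceless_part m).
Proof.
by move=> H; apply: commrB; [exact: commrD|exact: scalar_mxC].
Qed.

Lemma traceless_comm_scale v w :
  \tr v = 0 -> \tr w = 0 -> w != 0 -> GRing.comm w v -> exists c, v = c *: w.
Proof.
move=> v0 w0 nw /comm2E[h1 h2 h3].
have v11 : v 1 1 = - v 0 0 by apply/eqP; rewrite -addr_eq0 addrC -tr2E v0.
have w11 : w 1 1 = - w 0 0 by apply/eqP; rewrite -addr_eq0 addrC -tr2E w0.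
have {}h2 : w 0 1 * v 0 0 = v 0 1 * w 0 0.
  apply: (mulfI two_neq0); move: h2; rewrite v11 w11 !opprK => h2.
  by transitivity (w 0 1 * (v 0 0 + v 0 0)); [ring|rewrite h2; ring].
have {}h3 : w 1 0 * v 0 0 = v 1 0 * w 0 0.
  apply: (mulfI two_neq0); move: h3; rewrite v11 w11 !opprK => h3.
  by transitivity (w 1 0 * (v 0 0 + v 0 0)); [ring|rewrite h3; ring].
have [p|p] := eqVneq (w 0 0) 0; last first.
  exists (v 0 0 / w 0 0); apply: mx2P; rewrite scalemx2E ?v11 ?w11; try by field.
    by apply: (mulIf p); rewrite -h2; field.
  by apply: (mulIf p); rewrite -h3; field.
have [q|q] := eqVneq (w 0 1) 0; last first.
  exists (v 0 1 / w 0 1); apply: mx2P; rewrite scalemx2E ?v11 ?w11; try by field.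
  - by apply: (mulfI q); rewrite h2; field.
  - by apply: (mulfI q); rewrite h1; field.
  - by apply: (mulfI q); rewrite mulrN h2; field.
have [r|r] := eqVneq (w 1 0) 0; last first.
  exists (v 1 0 / w 1 0); apply: mx2P; rewrite scalemx2E ?v11 ?w11; try by field.
  - by apply: (mulfI r); rewrite h3; field.
  - by apply: (mulfI r); rewrite -h1; field.
  - by apply: (mulfI r); rewrite mulrN h3; field.
case/negP: nw; apply/eqP; apply: mx2P; rewrite mxE //.
by rewrite w11 p oppr0.
Qed.

(** V represents a set of lines, and conjugation by B sends each of them to one of the set; the
    equation is cleared of B^-1. *)
Definition permutes_lines V B :=
  forall v, v \in V -> exists2 v', v' \in V & exists c, B * v = c *: (v' * B).

(** The right side is the Gram determinant of v and w for the polar form of det, whose value at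
    traceless v and w is -tr(v w). *)
Lemma commutator_det v w : \tr v = 0 -> \tr w = 0 ->
  \det (v * w - w * v) = 4 * \det v * \det w - (\tr (v * w)) ^+ 2.
Proof.
move=> v0 w0; rewrite tr2E !det2E !mx2E.
have -> : v 1 1 = - v 0 0 by apply/eqP; rewrite -addr_eq0 addrC -tr2E v0.
have -> : w 1 1 = - w 0 0 by apply/eqP; rewrite -addr_eq0 addrC -tr2E w0.
by ring.
Qed.

(** By [commutator_det] also tr(v w) = 0, so v and w span a totally isotropic space for det, which
    is too small to hold two independent vectors. Explicitly, the square of each coordinate of their
    cross product is a combination of det v, det w and tr(v w). *)
Lemma isotropic_commutator v w : \tr v = 0 -> \tr w = 0 ->
  \det v = 0 -> \det w = 0 -> \det (v * w - w * v) = 0 -> v * w - w * v = 0.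
Proof.
move=> v0 w0 dv dw; rewrite commutator_det // dv dw !mulr0 sub0r.
move/eqP; rewrite oppr_eq0 sqrf_eq0 tr2E !mulmx2E.
have v11 : v 1 1 = - v 0 0 by apply/eqP; rewrite -addr_eq0 addrC -tr2E v0.
have w11 : w 1 1 = - w 0 0 by apply/eqP; rewrite -addr_eq0 addrC -tr2E w0.
rewrite v11 w11 => /eqP tvw.
move: dv dw; rewrite !det2E v11 w11; set A := (X in X = 0) => A0; set D := (X in X = 0) => D0.
pose t := v 0 0 * w 0 0 + v 0 1 * w 1 0 + (v 1 0 * w 0 1 + - v 0 0 * - w 0 0).
have {}tvw : t = 0 by exact: tvw.
have h00 : v 0 1 * w 1 0 - v 1 0 * w 0 1 = 0.
  apply/eqP; rewrite -sqrf_eq0; apply/eqP.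
  transitivity (t * (v 0 1 * w 1 0 + v 1 0 * w 0 1 - 2 * v 0 0 * w 0 0)
     - 4 * ((v 0 0) ^+ 2 * D + A * (w 0 0) ^+ 2 + A * D)); last by rewrite tvw A0 D0; ring.
  by rewrite /t /A /D; ring.
have h01 : v 0 0 * w 0 1 - v 0 1 * w 0 0 = 0.
  apply/eqP; rewrite -sqrf_eq0; apply/eqP.
  transitivity (- A * (w 0 1) ^+ 2 - D * (v 0 1) ^+ 2 - v 0 1 * w 0 1 * t);
    last by rewrite tvw A0 D0; ring.
  by rewrite /t /A /D; ring.
have h10 : v 1 0 * w 0 0 - v 0 0 * w 1 0 = 0.
  apply/eqP; rewrite -sqrf_eq0; apply/eqP.
  transitivity (- D * (v 1 0) ^+ 2 - A * (w 1 0) ^+ 2 - v 1 0 * w 1 0 * t);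
    last by rewrite tvw A0 D0; ring.
  by rewrite /t /A /D; ring.
apply: mx2P; rewrite !mx2E ?v11 ?w11.
- by rewrite -[RHS]h00; ring.
- by transitivity (2 * (v 0 0 * w 0 1 - v 0 1 * w 0 0)); [ring|rewrite h01 mulr0].
- by transitivity (2 * (v 1 0 * w 0 0 - v 0 0 * w 1 0)); [ring|rewrite h10 mulr0].
- by transitivity (- (v 0 1 * w 1 0 - v 1 0 * w 0 1)); [ring|rewrite h00 oppr0].
Qed.

Lemma line_fixed_of_comm V v B : \det B = 1 -> v \in V ->
  (forall w, w \in V -> GRing.comm v w) -> permutes_lines V B -> line_fixed v B.
Proof.
move=> dB vV cV pV; have [w wV [c E]] := pV v vV.
have uB : B \is a GRing.unit by rewrite unitmxE dB unitr1.
rewrite /line_fixed E -scalerAl mulrK // /GRing.comm -scalerAr -scalerAl.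
by congr (_ *: _); exact: cV.
Qed.

(* If all the lines are isotropic, the commutators of pairs of them span a finite
   invariant set of anisotropic lines. *)
Lemma finite_orbit_dichotomy (P : 'M[K]_2 -> Prop) V :
  V != [::] -> (forall v, v \in V -> \tr v = 0 /\ v != 0) ->
  (forall B, P B -> \det B = 1 /\ permutes_lines V B) ->
  (exists2 w, ~~ is_scalar_mx w & forall B, P B -> line_fixed w B) \/
  exists V' v1 v2, [/\ forall v, v \in V' -> \det v != 0, v1 \in V', v2 \in V',
    ~ GRing.comm v1 v2 & forall B, P B -> permutes_lines V' B].
Proof.
move=> V0 trV pV.
have aniso V' : V' != [::] -> (forall v, v \in V' -> \tr v = 0 /\ \det v != 0) ->
    (forall B, P B -> permutes_lines V' B) ->
    (exists2 w, ~~ is_scalar_mx w & forall B, P B -> line_fixed w B) \/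
    exists V' v1 v2, [/\ forall v, v \in V' -> \det v != 0, v1 \in V', v2 \in V',
    ~ GRing.comm v1 v2 & forall B, P B -> permutes_lines V' B].
  case: V' => // v1 V' _; set W := v1 :: V' => trW pW.
  have v1W : v1 \in W by exact: mem_head.
  have [cW|] := classic (forall w, w \in W -> GRing.comm v1 w).
    left; exists v1; last by move=> B PB; apply: (line_fixed_of_comm _ v1W cW (pW B PB)); case: (pV B PB).
    have [t1 d1] := trW v1 v1W; rewrite traceless_scalar //.
    by apply: contra d1 => /eqP->; rewrite det2E !zeromx2E mulr0 subrr.
  move/not_all_ex_not => [v2 H]; have [v2W nc] := imply_to_and _ _ H.
  by right; exists W, v1, v2; split=> // v /trW[].
(* Conjugation multiplied by a scalar c changes det by c^2 only, so the anisotropic members of V, if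
   there are any, form an invariant family by themselves. *)
case: (boolP (has (fun v => \det v != 0) V)) => [hV|nV].
  apply: (aniso [seq v <- V | \det v != 0]); first by rewrite -has_filter.
    by move=> v; rewrite mem_filter => /andP[dv /trV[]].
  move=> B PB v; rewrite mem_filter => /andP[dv vV].
  have [dB /(_ v vV) [w wV [c E]]] := pV B PB.
  exists w; last by exists c.
  rewrite mem_filter wV andbT; apply: contra dv => /eqP dw.
  have := congr1 determinant E; rewrite detZ !det_mulmx dB dw mul1r mul0r mulr0.
  by move=> ->.
have iso v : v \in V -> \det v = 0.
  by move=> vV; apply/eqP; apply: contraNT nV => dv; apply/hasP; exists v.
case: V V0 trV pV {nV} iso => // v1 V _; set W := v1 :: V => trW pW iso.
have v1W : v1 \in W by exact: mem_head.
have [cW|] := classic (forall w, w \in W -> GRing.comm v1 w).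
  left; exists v1; last by move=> B /pW[dB pB]; exact: (line_fixed_of_comm dB v1W cW pB).
  by have [t1 n1] := trW v1 v1W; rewrite traceless_scalar.
move/not_all_ex_not => [v2 H]; have [v2W nc] := imply_to_and _ _ H.
pose V' := [seq u <- [seq v * w - w * v | v <- W, w <- W] | u != 0].
apply: (aniso V').
- rewrite -has_filter; apply/hasP; exists (v1 * v2 - v2 * v1).
    by apply/allpairsP; exists (v1, v2).
  by rewrite subr_eq0; apply/negP => /eqP.
- move=> u; rewrite mem_filter => /andP[u0 /allpairsP[[v w] [/= vW wW uE]]].
  have [tv _] := trW v vW; have [tw _] := trW w wW.
  split; first by rewrite uE linearB /= mxtrace_mulC subrr.
  by apply: contra u0 => /eqP du; rewrite uE (isotropic_commutator tv tw (iso v vW) (iso w wW)) // -uE.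
- move=> B PB u; rewrite mem_filter => /andP[u0 /allpairsP[[v w] [/= vW wW uE]]].
  have [dB pB] := pW B PB; have uB : B \is a GRing.unit by rewrite unitmxE dB unitr1.
  have [v' v'W [c Ev]] := pB v vW; have [w' w'W [d Ew]] := pB w wW.
  have E : B * u = (c * d) *: ((v' * w' - w' * v') * B).
    rewrite uE mulrBr !mulrA Ev Ew -!scalerAl -!mulrA Ev Ew -!scalerAr !scalerA.
    by rewrite (mulrC d) -scalerBr mulrBl !mulrA.
  exists (v' * w' - w' * v'); last by exists (c * d).
  rewrite mem_filter; apply/andP; split; last by apply/allpairsP; exists (v', w').
  apply: contra u0 => /eqP u'0; move: E; rewrite u'0 mul0r scaler0 => E.
  by rewrite -(mulKr uB u) E mulr0.
Qed.

(** B is determined up to sign by finitely many data: the images of the lines of v1 and v2 and the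
    signs of the two scalars. If B and B' share these, B^-1 B' commutes with both v1 and v2, which
    do not commute, so it is scalar. *)
Lemma permutes_lines_covered V v1 v2 :
  (forall v, v \in V -> \det v != 0) -> v1 \in V -> v2 \in V -> ~ GRing.comm v1 v2 ->
  covered (fun B => \det B = 1 /\ permutes_lines V B).
Proof.
move=> dV v1V v2V nc.
pose moves v B v' := exists c, B * v = c *: (v' * B).
apply: (@covered_by_fibres _ _ _ (fun B u => moves v1 B u.1 /\ moves v2 B u.2)
  [seq (w1, w2) | w1 <- V, w2 <- V]).
  move=> B [_ pB]; have [w1 w1V m1] := pB v1 v1V; have [w2 w2V m2] := pB v2 v2V.
  by exists (w1, w2) => //; apply/allpairsP; exists (w1, w2).
move=> [w1 w2] _ /=.
(* Taking determinants fixes the scalar up to a sign, because det v <> 0. *)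
apply: covered_of_base => C [[dC _] [[c1 C1] [c2 C2]]].
have uC : C \is a GRing.unit by rewrite unitmxE dC unitr1.
pose signed (v w B : 'M[K]_2) (c : K) (e : bool) := B * v = ((if e then -1 else 1) * c) *: (w * B).
have sign v w c B : v \in V -> \det B = 1 -> C * v = c *: (w * C) ->
    moves v B w -> exists e, signed v w B c e.
  move=> vV dB CE [d BE].
  have /eqP : c ^+ 2 * \det w = d ^+ 2 * \det w.
    have := congr1 determinant CE; have := congr1 determinant BE.
    by rewrite !detZ !det_mulmx dC dB !mul1r !mulr1 => <- <-.
  rewrite (inj_eq (mulIf _)); last first.
    apply: contra (dV v vV) => /eqP dw; have := congr1 determinant CE.
    by rewrite detZ !det_mulmx dC dw mul1r mul0r mulr0 => ->.
  rewrite eqf_sqr => /orP[/eqP->|/eqP->]; [exists false|exists true].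
    by rewrite /signed mul1r.
  by rewrite /signed mulN1r opprK.
apply: (@covered_by_fibres _ _ _ (fun B e => signed v1 w1 B c1 e.1 /\ signed v2 w2 B c2 e.2)
  [seq (e1, e2) | e1 <- [:: true; false], e2 <- [:: true; false]]).
  move=> B [[dB _] [m1 m2]]; have [e1 s1] := sign _ _ _ _ v1V dB C1 m1.
  have [e2 s2] := sign _ _ _ _ v2V dB C2 m2.
  by exists (e1, e2) => //; apply/allpairsP; exists (e1, e2); split=> //; [case: (e1)|case: (e2)].
move=> [e1 e2] _ /=; apply: covered_of_base => B [[[dB _] _] [B1 B2]].
have uB : B \is a GRing.unit by rewrite unitmxE dB unitr1.
exists [:: B; - B] => B' [[[dB' _] _] [B'1 B'2]].
have com v w c e : signed v w B c e -> signed v w B' c e -> GRing.comm (B^-1 * B') v.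
  rewrite /signed; set k := _ * c => E E'.
  have Ev : v * B^-1 = k *: (B^-1 * w).
    by rewrite -[v in LHS](mulKr uB) E -scalerAr -scalerAl mulrA mulrK.
  by rewrite /GRing.comm -mulrA E' mulrA Ev -scalerAr -scalerAl mulrA.
have /negPn/is_scalar_mxP[c cE] : ~~ ~~ is_scalar_mx (B^-1 * B').
  by apply/negP => ns; apply: nc; apply: (comm2_trans ns); [exact: com B1 B'1|exact: com B2 B'2].
have BE : B' = c *: B by rewrite -[LHS](mulVKr uB) cE -scalemx1 -scalerAr mulr1.
have : c ^+ 2 == 1 by have := congr1 determinant BE; rewrite detZ dB dB' mulr1 => <-.
rewrite sqrf_eq1 !inE BE => /orP[]/eqP->.
  by rewrite scale1r eqxx.
by rewrite scaleN1r eqxx orbT.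
Qed.

End LineOrbits.

(** * Small tripling gives a fixed line or a finite set of permuted lines *)

Section Dichotomy.
Local Open Scope ring_scope.
Variables (K : fieldType) (A : seq (SL2 K)).
Hypotheses (two_neq0 : (2 : K) != 0) (uA : uniq A).

Lemma size_le_triple (G : groupType) (B : seq G) : uniq B ->
  (size B <= size (word B [:: true; true; true]))%N.
Proof.
case EB : B => [//|x B']; rewrite -EB => uB.
have xB : x \in letter B true by rewrite /= EB mem_head.
apply: leq_trans (@size_word_rcons _ B [:: true; true] x true xB).
apply: leq_trans (@size_word_rcons _ B [:: true] x true xB).
by apply: uniq_leq_size => // y yB; rewrite mem_word1.
Qed.

Lemma conj_traceless_part (B m : 'M[K]_2) : B \is a GRing.unit ->
  traceless_part (B * m * B^-1) = B * traceless_part m * B^-1.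
Proof.
move=> uB; rewrite /traceless_part mxtrace_mulC mulmxE mulrA mulVr // mul1r.
rewrite mulrBr mulrBl mulrDr mulrDl; congr (_ - _).
by rewrite -scalemx1 -scalerAr -scalerAl mulr1 mulrV.
Qed.

(** V consists of the lines of the non-scalar elements of A^-1 A. A conjugate of such an element by
    a letter is a word of length 4, so by [rich_centralizer] it commutes with a non-scalar element
    of A^-1 A and spans the same line. *)
Lemma small_tripling_dichotomy :
  (2 ^ 17 * size (word A [:: true; true; true]) ^ 231 < size A ^ 232)%N ->
  invariant_line A \/
  exists V v1 v2, [/\ forall v, v \in V -> \det v != 0, v1 \in V, v2 \in V,
    ~ GRing.comm v1 v2 &
    forall b : SL2 K, b \in A -> permutes_lines V (b : 'M[K]_2) /\ permutes_lines V (b : 'M[K]_2)^-1].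
Proof.
move=> big; have [//|nline] := classic (invariant_line A); first by left.
have at_ := size_le_triple uA; set t := size (word _ _) in big at_.
have a0 : (0 < size A)%N.
  by rewrite lt0n; apply/negP => /eqP a0; move: big; rewrite a0 exp0n.
have chain N : (size A ^ 32 * N <= t ^ 33)%N -> _ :=
  fun h => density_chain rat (introT andP (conj a0 at_)) h big.
have A0 : A != [::] by rewrite -size_eq0 -lt0n.
(* Only the first conclusion of [chain] is wanted, so N = 0 suffices. *)
have a2 : (2 < size A)%N.
  have h0 : (size A ^ 32 * 0 <= t ^ 33)%N by rewrite muln0.
  by have [] := chain _ h0 (size A) (leq_pmull _ (isT : (0 < 2)%N)).
have rich w g : size w = 4 -> g \in word A w -> nonscalar g ->
    exists x y, [/\ x \in A, y \in A, nonscalar (x^-1 * y)%g & commute g (x^-1 * y)%g].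
  move=> sw gw ng; pose wS := true :: w ++ [:: false].
  (* The pattern wS has length 6, and wS, one letter and the inverse of wS have total length 13.
     Thus n = 10 in [size_word_bound], whence the exponents 32 and 33. *)
  have sW : size (wS ++ true :: word_inv wS) = (10 + 3)%N.
    by rewrite size_cat /= size_rev size_map /= !size_cat sw.
  have hN := size_word_bound uA sW.
  by have [] := @rich_centralizer K A uA wS w g erefl gw ng (chain _ hN) A0.
pose H := [seq h <- pset (iset A) A | nonscalar h].
have memH x y : x \in A -> y \in A -> nonscalar (x^-1 * y)%g -> (x^-1 * y)%g \in H.
  move=> xA yA n; rewrite mem_filter; apply/andP; split; first exact: n.
  by apply: mem_pset => //; rewrite mem_iset invgK.
have HP h : h \in H -> nonscalar h /\ h \in word A [:: false; true].
  rewrite mem_filter => /andP[nh /psetP[x [y [xA yA E]]]]; split=> //.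
  by rewrite E; apply: mem_pset => //; rewrite mem_word1.
pose V : seq 'M[K]_2 := [seq traceless_part (mx_of_SL2 h) | h <- H].
have perm (u : SL2 K) (w : seq bool) : size w = 4 ->
    (forall h, h \in H -> (u * h * u^-1)%g \in word A w) -> permutes_lines V (u : 'M[K]_2).
  move=> sw uw _ /mapP[h hH ->]; have [nh _] := HP h hH.
  have [|x [y [xA yA n c]]] := rich w _ sw (uw h hH); first by rewrite nonscalar_conj.
  exists (traceless_part (mx_of_SL2 (x^-1 * y)%g)); first by apply: map_f; exact: memH.
  have uu := SL2_unit u.
  have [||||k E] := @traceless_comm_scale K two_neq0
    (traceless_part (mx_of_SL2 (u * h * u^-1)%g)) (traceless_part (mx_of_SL2 (x^-1 * y)%g)).
  - exact: tr_traceless_part.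
  - exact: tr_traceless_part.
  - rewrite -traceless_scalar ?tr_traceless_part // traceless_part_scalar //.
  - apply: comm_traceless_part; apply: commr_sym; apply: comm_traceless_part.
    exact/SL2_commE.
  exists k; rewrite scalerAl -E conj_traceless_part // mulrVK //.
have [||B PB||] := @finite_orbit_dichotomy K two_neq0
  (fun B => exists2 b : SL2 K, b \in A & B = (b : 'M[K]_2) \/ B = (b : 'M[K]_2)^-1) V.
- have [x [y [xA yA n]]] := nonscalar_ratio uA a2.
  by have := memH _ _ xA yA n; rewrite /V; case: (H).
- move=> _ /mapP[h /HP[nh _] ->]; split; first exact: tr_traceless_part.
  by rewrite -traceless_scalar ?tr_traceless_part // traceless_part_scalar.
- case: PB => b bA [] ->.
    split; first exact: SL2_det.
    apply: (perm b [:: true; false; true; false]) => // h /HP[_ hw].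
    rewrite -mulgA; apply: mem_pset => //.
    by apply: (@mem_word_cat _ A [:: false; true] [:: false]) => //; rewrite mem_word1 mem_iset invgK.
  split; first by rewrite -SL2_invE SL2_det.
  rewrite -SL2_invE; apply: (perm _ [:: false; false; true; true]) => // h /HP[_ hw].
  rewrite -mulgA; apply: mem_pset; first by rewrite mem_iset invgK.
  by apply: (@mem_word_cat _ A [:: false; true] [:: true]) => //; rewrite mem_word1 invgK.
- case=> w nw fw; case: nline; exists w => // b bA; apply: fw; exists b => //; by left.
- case=> [V' [v1 [v2 [dV v1V v2V nc pV]]]]; right; exists V', v1, v2; split=> // b bA.
  by split; apply: pV; exists b => //; [left|right].
Qed.

End Dichotomy.

(** * Back to the integral domain *)

Section Transfer.
Local Open Scope ring_scope.
Variables (D : idomainType) (K : fieldType) (f : {rmorphism D -> K}) (A : seq 'M[D]_2).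
Hypothesis f_inj : injective f.
Hypothesis A_SL2 : forall a, a \in A -> inSL2 a.
Let phi (x : 'M[D]_2) : 'M[K]_2 := map_mx f x.
Implicit Types (x y : 'M[D]_2) (X Y w : 'M[K]_2).

Let phi_inj : injective phi.
Proof.
by move=> x y /matrixP E; apply/matrixP => i j; apply: f_inj; have := E i j; rewrite !mxE.
Qed.

Let phiM x y : phi (x *m y) = phi x * phi y.
Proof. exact: map_mxM. Qed.

Let phi_det x : \det x = 1 -> \det (phi x) = 1.
Proof. by move=> dx; rewrite det_map_mx dx rmorph1. Qed.

Let phiV x : \det x = 1 -> phi (invmx x) = (phi x)^-1.
Proof.
move=> dx; have ux : x \in unitmx by rewrite unitmxE dx unitr1.
have uX : phi x \is a GRing.unit by rewrite unitmxE phi_det ?unitr1.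
apply: (mulrI uX); rewrite mulrV // -phiM mulmxV //; exact: map_mx1.
Qed.

Lemma gen_det x : gen A x -> \det x = 1.
Proof.
elim=> [y /A_SL2/eqP//||y z _ dy _ dz|y _ dy]; first exact: det1.
  by rewrite det_mulmx dy dz mulr1.
by rewrite det_inv dy invr1.
Qed.

Lemma gen_closed (Q : 'M[K]_2 -> Prop) :
  (forall a, a \in A -> Q (phi a)) -> Q 1 ->
  (forall X Y, \det X = 1 -> \det Y = 1 -> Q X -> Q Y -> Q (X * Y)) ->
  (forall X, \det X = 1 -> Q X -> Q X^-1) ->
  forall x, gen A x -> Q (phi x).
Proof.
move=> QA Q1 QM QV x; elim=> [y /QA//||y z gy Qy gz Qz|y gy Qy].
- by have -> : phi 1%:M = 1 by exact: map_mx1.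
- by rewrite phiM; apply: QM => //; apply/phi_det/gen_det.
- by rewrite phiV; [apply: QV => //; exact/phi_det/gen_det|exact: gen_det].
Qed.

Lemma scale_conjM v X Y (c d : K) :
  X * v = c *: (v * X) -> Y * v = d *: (v * Y) -> X * Y * v = (d * c) *: (v * (X * Y)).
Proof.
by move=> EX EY; rewrite -(mulrA X) EY -scalerAr (mulrA X v) EX -scalerAl scalerA -(mulrA v).
Qed.

Lemma scale_conjV v X (c : K) : X \is a GRing.unit -> c != 0 ->
  X * v = c *: (v * X) -> X^-1 * v = c^-1 *: (v * X^-1).
Proof.
move=> uX c0 EX; apply: (scalerI c0); rewrite scalerA mulfV // scale1r.
have -> : v * X^-1 = X^-1 * (X * v) * X^-1 by rewrite mulKr.
by rewrite EX -scalerAr -scalerAl mulrA mulrK.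
Qed.

(** Every x in the group satisfies x v x^-1 = c v with a nonzero c depending multiplicatively on x.
    The normal subgroup is the kernel of this character, the centralizer of v: it is abelian since v
    is not scalar, and it contains all commutators. *)
Lemma invariant_line_metabelian w : (2 : K) != 0 -> ~~ is_scalar_mx w ->
  (forall a, a \in A -> line_fixed w (phi a)) -> metabelian (gen A).
Proof.
move=> n2 nw fw; pose v := traceless_part w.
have tv : \tr v = 0 := tr_traceless_part w.
have nv : ~~ is_scalar_mx v by rewrite traceless_part_scalar.
have v0 : v != 0 by rewrite -traceless_scalar.
have scal : forall x, gen A x -> exists2 c, c != 0 & phi x * v = c *: (v * phi x).
  apply: (@gen_closed (fun X => exists2 c, c != 0 & X * v = c *: (v * X))).
  - move=> a aA; have da : \det (phi a) = 1 by apply/phi_det/eqP/A_SL2.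
    have ua : phi a \is a GRing.unit by rewrite unitmxE da unitr1.
    have [||||c E] := @traceless_comm_scale K n2 (phi a * v * (phi a)^-1) v.
    + by rewrite mxtrace_mulC mulmxE mulKr.
    + by [].
    + by [].
    + rewrite -conj_traceless_part //; apply: comm_traceless_part; apply: commr_sym.
      by apply: comm_traceless_part; apply: commr_sym; exact: fw.
    have E' : phi a * v = c *: (v * phi a) by rewrite scalerAl -E mulrVK.
    exists c => //; apply: contra v0 => /eqP c0.
    by rewrite -(mulKr ua v) E' c0 scale0r mulr0.
  - by exists 1; rewrite ?oner_eq0 // scale1r mul1r mulr1.
  - move=> X Y _ _ [c c0 EX] [d d0 EY]; exists (d * c); first by rewrite mulf_neq0.
    exact: scale_conjM.
  - move=> X dX [c c0 EX]; exists c^-1; first by rewrite invr_eq0.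
    by apply: scale_conjV => //; rewrite unitmxE dX unitr1.
have genU x : gen A x -> phi x \is a GRing.unit.
  by move=> /gen_det/phi_det dx; rewrite unitmxE dx unitr1.
exists (fun x => gen A x /\ GRing.comm v (phi x)); do !split.
- by move=> x [].
- exact: gen_one.
- have -> : phi 1%:M = 1 by exact: map_mx1.
  exact: commr1.
- by apply: gen_mul; [case: H|case: H0].
- by rewrite phiM; apply: commrM; [case: H|case: H0].
- by apply: gen_inv; case: H.
- by case: H => gx cx; rewrite phiV; [exact: commrV|exact: gen_det].
- by case: H0 => gn _; apply: gen_mul; [exact: gen_mul|exact: gen_inv].
- case: H0 => gn cn; rewrite !phiM phiV; last exact: gen_det.
  have uG := genU _ H; have [c c0 E] := scal _ H.
  have nG : ~~ is_scalar_mx (phi g * v * (phi g)^-1) by rewrite conj2_scalar.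
  apply: (comm2_trans nG); last exact: conj2_comm.
  by rewrite E -scalerAl mulrK // /GRing.comm -scalerAr -scalerAl.
- move=> x y [gx cx] [gy cy]; apply: phi_inj; rewrite !phiM.
  exact: (comm2_trans nv cx cy).
- by apply: gen_mul; [apply: gen_mul; [exact: gen_mul|exact: gen_inv]|exact: gen_inv].
- have [c c0 Eg] := scal _ H; have [d d0 Eh] := scal _ H0.
  have [uG uH] := (genU _ H, genU _ H0).
  rewrite !phiM !phiV; try exact: gen_det.
  have := scale_conjM (scale_conjM (scale_conjM Eg Eh) (scale_conjV uG c0 Eg)) (scale_conjV uH d0 Eh).
  have -> : d^-1 * (c^-1 * (d * c)) = 1 by rewrite (mulrC d) mulKf // mulVf.
  by rewrite scale1r.
Qed.

Lemma permuted_lines_covered V v1 v2 :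
  (forall v, v \in V -> \det v != 0) -> v1 \in V -> v2 \in V -> ~ GRing.comm v1 v2 ->
  (forall a, a \in A -> permutes_lines V (phi a) /\ permutes_lines V (phi a)^-1) ->
  covered (gen A).
Proof.
move=> dV v1V v2V nc pA; have [s Hs] := permutes_lines_covered dV v1V v2V nc.
have pM X Y : permutes_lines V X -> permutes_lines V Y -> permutes_lines V (X * Y).
  move=> pX pY v /pY[w /pX[u uV [c Ec]] [d Ed]]; exists u => //; exists (d * c).
  by rewrite -(mulrA X) Ed -scalerAr (mulrA X w) Ec -scalerAl scalerA -(mulrA u).
have p1 : permutes_lines V 1.
  by move=> v vV; exists v => //; exists 1; rewrite scale1r mul1r mulr1.
(* Carrying x and x^-1 together makes the induction step for inverses a mere exchange. *)
have perm : forall x, gen A x -> permutes_lines V (phi x) /\ permutes_lines V (phi x)^-1.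
  apply: (@gen_closed (fun X => permutes_lines V X /\ permutes_lines V X^-1)).
  - exact: pA.
  - by rewrite invr1.
  - move=> X Y dX dY [pX pX'] [pY pY']; split; first exact: pM.
    by rewrite invrM ?unitmxE ?dX ?dY ?unitr1 //; exact: pM.
  - by move=> X _ [pX pX']; rewrite invrK.
apply: (@covered_by_fibres _ _ _ (fun x X => phi x = X) s).
  move=> x gx; exists (phi x) => //; apply: Hs; split; last by case: (perm x gx).
  exact/phi_det/gen_det.
move=> X _; apply: covered_of_base => y [_ yX]; exists [:: y] => x [_ xX].
by rewrite inE; apply/eqP/phi_inj; rewrite xX yX.
Qed.

Theorem tripling_bound : (2 : K) != 0 -> uniq A ->
  infinite_set (gen A) -> ~ metabelian (gen A) ->
  (size A ^ 232 <= 2 ^ 17 * size (AAA A) ^ 231)%N.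
Proof.
move=> n2 uA infA nmet; rewrite leqNgt; apply/negP => big.
(* The default 1 never occurs for elements of A, whose images have determinant 1. *)
pose lift x : SL2 K := insubd (1%g : SL2 K) (phi x).
have liftE a : a \in A -> mx_of_SL2 (lift a) = phi a.
  by move=> aA; apply: insubdK; apply/eqP/phi_det/eqP/A_SL2.
pose B := map lift A.
have uB : uniq B.
  by rewrite map_inj_in_uniq // => a b aA bA /(congr1 (@mx_of_SL2 _)); rewrite !liftE // => /phi_inj.
have tB : (size (word B [:: true; true; true]) <= size (AAA A))%N.
  rewrite -(size_map phi); apply: (@size_le_inj _ _ (@mx_of_SL2 K)).
  - exact: uniq_word.
  - by move=> x y _ _; exact: SL2_inj.
  move=> z /psetP[x1 [y1 [/mapP[a aA ->] /psetP[x2 [y2 [/mapP[b bA ->]]]]]]].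
  move=> /psetP[x3 [e [/mapP[c cA ->]]]]; rewrite inE => /eqP-> -> -> ->.
  rewrite mulg1 !SL2_mulE !liftE // mulrA -!phiM; apply: map_f; rewrite mem_undup.
  apply/allpairsP; exists (a *m b, c); split=> //.
  by apply/allpairsP; exists (a, b).
have sB : size B = size A by rewrite size_map.
have [] := small_tripling_dichotomy n2 uB.
- rewrite sB; apply: leq_ltn_trans big; rewrite leq_mul2l; apply/orP; right.
  by rewrite leq_exp2r.
- case=> w nw fw; apply: nmet; apply: (invariant_line_metabelian n2 nw) => a aA.
  by have := fw _ (map_f lift aA); rewrite liftE.
case=> V [v1 [v2 [dV v1V v2V nc pV]]]; apply: infA.
have [s Hs] := permuted_lines_covered dV v1V v2V nc
  (fun a aA => ltac:(by have := pV _ (map_f lift aA); rewrite liftE)).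
by exists s.
Qed.

End Transfer.

Lemma fraction_two_neq0 (D : idomainType) : char_zero D -> (2 != 0 :> {fraction D})%R.
Proof.
by move=> /(_ 2); rewrite !inE /= => n2; rewrite -tofrac1 -tofracMn tofrac_eq0 n2.
Qed.

(** This makes A nonempty in the theorem, so that real powers of |A| have a positive base. *)
Lemma gen_nil_covered (D : idomainType) : covered (gen (D := D) [::]).
Proof.
exists [:: 1%:M]%R => x; elim=> [y //||y z _ /[!inE]/eqP-> _ /eqP->|y _ /[!inE]/eqP->].
- by rewrite inE.
- by rewrite mul1mx.
- by rewrite invmx1.
Qed.

(* Passage to real exponents *)
From Stdlib Require Import Reals Lra.

Lemma INR_expn (a n : nat) : INR (expn a n) = (INR a ^ n)%R.
Proof. by elim: n => [//|n IH]; rewrite expnS mult_INR IH. Qed.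

(** Taking n-th roots gives t at least 2^(-k/n) a^(1 + 1/n), and 2^(-k/n) exceeds 1/2 because k < n.
    The proof compares n-th powers instead of taking roots. *)
Lemma Rpower_gap (a t n k : nat) : ltn 0 a -> ltn k n ->
  leq (expn a n.+1) (muln (expn 2 k) (expn t n)) ->
  (INR t > / 2 * Rpower (INR a) (1 + / INR n))%R.
Proof.
move=> a0 kn /ssrnat.leP/le_INR; rewrite mult_INR !INR_expn => H.
have A0 : (0 < INR a)%R by apply: lt_0_INR; apply/ssrnat.ltP.
have N0 : (0 < INR n)%R by apply: lt_0_INR; apply/ssrnat.ltP; apply: leq_ltn_trans kn.
apply: Rnot_le_gt => tle; set p := Rpower _ _ in tle.
have pE : (p ^ n = INR a ^ n.+1)%R.
  rewrite -!Rpower_pow ?Rpower_mult //; last exact: exp_pos.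
  rewrite S_INR Rmult_plus_distr_r Rmult_1_l Rinv_l //; exact: Rgt_not_eq.
have tn : (INR t ^ n <= (/ 2) ^ n * INR a ^ n.+1)%R.
  rewrite -pE -Rpow_mult_distr; apply: pow_incr; split=> //; exact: pos_INR.
have P0 : (0 < INR a ^ n.+1)%R by exact: pow_lt.
have K0 : (0 < 2 ^ k)%R by apply: pow_lt; Lra.lra.
have E2 : INR 2 = 2%R by [].
have half : (2 ^ k * (/ 2) ^ n < 1)%R.
  have -> : n = (k + (n - k))%coq_nat by rewrite plusE subnKC // ltnW.
  rewrite pow_add -Rmult_assoc -Rpow_mult_distr Rinv_r; last by Lra.lra.
  rewrite pow1 Rmult_1_l; apply: (proj2 (pow_lt_1_compat (/ 2) (subn n k) _ _)); first Lra.lra.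
  by apply/ssrnat.ltP; rewrite subn_gt0.
rewrite E2 in H.
have := Rmult_le_compat_l _ _ _ (Rlt_le _ _ K0) tn.
Lra.nra.
Qed.

Theorem mainTheorem6 :
  exists c delta : R, (0 < c)%R /\ (0 < delta)%R /\
  forall (D : idomainType) (A : seq 'M[D]_2),
    char_zero D ->
    uniq A ->
    (forall a, a \in A -> inSL2 a) ->
    infinite_set (gen A) ->
    ~ metabelian (gen A) ->
    (INR (size (AAA A)) > c * Rpower (INR (size A)) (1 + delta))%R.
Proof.
have n0 : (0 < INR 231)%R by apply: lt_0_INR; apply/ssrnat.ltP.
(* From a^232 at most 2^17 t^231 one gets delta = 1/231, and c = 1/2 works since 17 < 231. *)
exists (/ 2)%R, (/ INR 231)%R; split; first Lra.lra.
split; first exact: Rinv_0_lt_compat.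
move=> D A char0 uA sA infA nmet; apply: (@Rpower_gap _ _ 231 17) => //.
  case: A infA {uA sA nmet} => // infA.
  by case: infA; exact: gen_nil_covered.
apply: (@tripling_bound D {fraction D} (@tofrac D) A) => //.
  by move=> x y /eqP; rewrite tofrac_eq => /eqP.
exact: fraction_two_neq0.
Qed.
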